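(* Let $H$ be a Hilbert space, let $\mathcal{A}\subseteq B(H)$ be a $C^*$-algebra, let $\bar{\mathcal{A}}$ be the ultra-weak closure of $\mathcal{A}$ in $B(H)$, let $\tau$ be a faithful normal trace on $\bar{\mathcal{A}}$, and let $X$ be a normal dual $\bar{\mathcal{A}}$-bimodule. Then, for every $n\in\mathbb{N}$ ($n\ge 1$), $$\mathcal{H}^n_{sw}(\mathcal{A},X)=\mathcal{H}^n_{s}(\mathcal{A},X),$$ where the two vector spaces are identified through the natural inclusion of cochains $BL^n_{sw}(\mathcal{A},X)\subseteq BL^n_s(\mathcal{A},X)$.
   Context: UWOT denotes the ultra-weak operator topology on $B(H)$, and $\mathcal{A}_1$ the closed unit ball of $\mathcal{A}$. Traces: a (finite) trace $\tau$ on a $C^*$-algebra is a positive linear functional with $\tau(ab)=\tau(ba)$; it is faithful if $\tau(a^*a)=0$ implies $a=0$. Put $\|a\|_\tau=\tau(a^*a)^{1/2}$. On $\mathcal{A}$ one uses the restriction of $\tau$. A linear map from $\mathcal{A}$ to a Banach space is smooth if its restriction to $\mathcal{A}_1$ is continuous from the $\|\cdot\|_\tau$-topology to the norm topology. An $n$-linear map is smooth if it is smooth in each argument separately. An element $x$ of a Banach $\mathcal{A}$-bimodule $X$ is smooth if the maps $a\mapsto a\cdot x$ and $a\mapsto x\cdot a$, $\mathcal{A}\to X$, are smooth; $X_\tau$ is the closed submodule of smooth elements. A Banach $\bar{\mathcal{A}}$-bimodule $X$ is dual if it is the dual of a Banach space and for each $a$ the maps $x\mapsto a\cdot x$ and $x\mapsto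 x\cdot a$ are weak* continuous. It is normal if moreover for every $x\in X$ the maps $a\mapsto a\cdot x$, $a\mapsto x\cdot a$ are UWOT-weak* continuous on $\bar{\mathcal{A}}$. An $\bar{\mathcal{A}}$-bimodule is regarded as an $\mathcal{A}$-bimodule by restriction. $BL^n(\mathcal{A},X)$ ($n\ge1$) is the space of bounded $n$-linear maps $\mathcal{A}^n\to X$; $BL^n_s(\mathcal{A},X)$ is the subspace of smooth maps and $BL^n_{sw}(\mathcal{A},X)$ the subspace of maps that are smooth and separately UWOT-weak* continuous. $BL^0(\mathcal{A},X)=X$ and $BL^0_s(\mathcal{A},X)=BL^0_{sw}(\mathcal{A},X)=X_\tau$. The coboundary operators are $\delta^0(x)(a)=a\cdot x-x\cdot a$ and, for $n\ge1$, $$(\delta^nT)(a_1,\dots,a_{n+1})=a_1\cdot T(a_2,\dots,a_{n+1})+\sum_{k=1}^n(-1)^kT(a_1,\dots,a_ka_{k+1},\dots,a_{n+1})+(-1)^{n+1}T(a_1,\dots,a_n)\cdot a_{n+1}.$$ For $\bullet\in\{s,sw\}$ let $\mathcal{Z}^n_{\bullet}(\mathcal{A},X)=\{T\in BL^n_{\bullet}(\mathcal{A},X):\delta^nT=0\}$. Then $\mathcal{H}^n_{\bullet}(\mathcal{A},X)$ is the quotient of $\mathcal{Z}^n_{\bullet}(\mathcal{A},X)$ in which two cocycles are identified when their difference is $\delta^{n-1}\psi$ for some $\psi\in BL^{n-1}_{\bullet}(\mathcal{A},X)$. *)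

(* Defs.v *)
From HB Require Import structures.
From mathcomp Require Import all_boot all_order all_algebra.
From mathcomp Require Import sesquilinear ring_quotient generic_quotient.
From mathcomp Require Import complex.
From mathcomp Require Import all_classical all_reals all_analysis.

Set Implicit Arguments.
Unset Strict Implicit.
Unset Printing Implicit Defensive.

Import Order.TTheory GRing.Theory Num.Theory.
Import numFieldNormedType.Exports.

Local Open Scope classical_set_scope.
Local Open Scope complex_scope.
Local Open Scope ring_scope.

Section Bop.
Context {R : realType}.
(* Norms of normed spaces over C = R[i] take their values in C. For the order
   of R[i], x <= y means that y - x is a nonnegative real. *)
Local Notation C := R[i].
Variables U V : normedModType C.

Definition bounded_linear : {pred U -> V} :=
  [pred f | `[< linear f /\ exists M : C, forall x, `|f x| <= M * `|x| >]].

Lemma bounded_linearP (f : U -> V) :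
  reflect (linear f /\ exists M : C, forall x, `|f x| <= M * `|x|)
    (f \in bounded_linear).
Proof. exact: asboolP. Qed.

Lemma bounded_linear_submod : submod_closed bounded_linear.
Proof.
split.
  apply/bounded_linearP; split; first by move=> a x y /=; rewrite scaler0 addr0.
  by exists 0 => x; rewrite normr0 mul0r.
move=> a f g /bounded_linearP[fl [M fM]] /bounded_linearP[gl [N gN]].
apply/bounded_linearP; split=> [b x y|].
  rewrite /= !fctE fl gl !scalerDr !scalerA (mulrC a b) -!addrA.
  by congr (_ + _); rewrite addrCA.
exists (`|a| * M + N) => x; rewrite mulrDl -mulrA.
apply: (le_trans (ler_normD _ _)); apply: lerD => //.
by rewrite normrZ ler_wpM2l.
Qed.

HB.instance Definition _ := GRing.isSubmodClosed.Build C (U -> V) bounded_linear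
  (GRing.submod_closed_semi bounded_linear_submod).

Record bop := Bop { bop_fun :> U -> V; bop_bounded : bop_fun \in bounded_linear }.

HB.instance Definition _ := [isSub for bop_fun].
HB.instance Definition _ := [Choice of bop by <:].
HB.instance Definition _ := [SubChoice_isSubLmodule of bop by <:].

Lemma bop_linear (f : bop) : linear f.
Proof. by have /bounded_linearP[] := bop_bounded f. Qed.

Lemma bop0 (f : bop) : f 0 = 0.
Proof.
by have := bop_linear f (-1) 0 0; rewrite !scaleN1r !addNr.
Qed.

Lemma bopZ (f : bop) (a : C) x : f (a *: x) = a *: f x.
Proof. by have := bop_linear f a x 0; rewrite bop0 !addr0. Qed.

Definition op_norm (f : bop) : R :=
  sup [set complex.Re `|f x| | x in [set x : U | `|x| <= 1]].

Let normE (W : normedModType C) (w : W) : `|w| = (complex.Re `|w|)%:C.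
Proof. by rewrite RRe_real. Qed.

Let has_sup_op (f : bop) :
  has_sup [set complex.Re `|f x| | x in [set x : U | `|x| <= 1]].
Proof.
split; first by exists (complex.Re `|f 0|), 0 => //=; rewrite normr0.
have /bounded_linearP[_ [M fM]] := bop_bounded f.
exists (complex.Re `|M|) => _ [x /= x1 <-].
rewrite -lecR -!normE (le_trans (fM x))//.
have /ger0_norm <- : 0 <= M * `|x| by exact: le_trans (fM x).
by rewrite normrM normr_id ler_piMr.
Qed.

Let op_norm_ub (f : bop) x : `|x| <= 1 -> `|f x| <= (op_norm f)%:C.
Proof.
move=> x1; rewrite normE lecR; apply: ub_le_sup; first by case: (has_sup_op f).
by exists x.
Qed.

Let op_norm_le (f : bop) (c : R) :
  (forall x, `|x| <= 1 -> `|f x| <= c%:C) -> op_norm f <= c.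
Proof.
move=> fc; apply: ge_sup; first by case: (has_sup_op f).
by move=> _ [x /= x1 <-]; rewrite -lecR -normE fc.
Qed.

Lemma op_norm_bound (f : bop) x : `|f x| <= (op_norm f)%:C * `|x|.
Proof.
have [->|x0] := eqVneq x 0; first by rewrite bop0 !normr0 mulr0.
have nx0 : 0 < `|x| by rewrite normr_gt0.
rewrite -ler_pdivrMr// mulrC.
have -> : `|x|^-1 * `|f x| = `|f (`|x|^-1 *: x)|.
  by rewrite bopZ normrZ normfV normr_id.
by apply: op_norm_ub; rewrite normrZ normfV normr_id mulVf ?gt_eqF.
Qed.

Let op_normD (f g : bop) : (op_norm (f + g))%:C <= (op_norm f)%:C + (op_norm g)%:C.
Proof.
rewrite -rmorphD lecR; apply: op_norm_le => x x1.
by rewrite rmorphD (le_trans (ler_normD _ _))// lerD// op_norm_ub.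
Qed.

Let op_normZ_le (a : C) (f : bop) : (op_norm (a *: f))%:C <= `|a| * (op_norm f)%:C.
Proof.
rewrite (normE (a : C^o)) -rmorphM lecR; apply: op_norm_le => x x1.
by rewrite rmorphM/= -(normE (a : C^o)) normrZ ler_wpM2l// op_norm_ub.
Qed.

Let op_normZ (a : C) (f : bop) : (op_norm (a *: f))%:C = `|a| * (op_norm f)%:C.
Proof.
have [->|a0] := eqVneq a 0.
  rewrite scale0r normr0 mul0r; congr _%:C; apply/eqP; rewrite eq_le.
  apply/andP; split; first by apply: op_norm_le => x _; rewrite /= normr0.
  by rewrite -lecR (le_trans _ (@op_norm_ub 0 0 _)) ?normr0.
apply/eqP; rewrite eq_le op_normZ_le/=.
rewrite -ler_pdivlMl ?normr_gt0// -normfV.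
by rewrite -{1}[f](scalerK a0) op_normZ_le.
Qed.

Let op_norm_eq0 (f : bop) : (op_norm f)%:C = 0 -> f = 0.
Proof.
move=> f0; apply/val_inj/funext => x /=; apply/eqP; rewrite -normr_le0.
by rewrite (le_trans (op_norm_bound _ _))// f0 mul0r.
Qed.

HB.instance Definition _ :=
  Lmodule_isNormed.Build C bop op_normD op_normZ op_norm_eq0.

Lemma bop_normE (f : bop) : `|f| = (op_norm f)%:C.
Proof. by []. Qed.

Lemma ler_bop (f : bop) x : `|f x| <= `|f| * `|x|.
Proof. by rewrite bop_normE op_norm_bound. Qed.

End Bop.
Arguments bop {R} U V.
Arguments bounded_linear {R U V}.

Section Comp.
Context {R : realType}.
Variables U V W : normedModType R[i].

Lemma bop_comp_subproof (f : bop V W) (g : bop U V) :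
  f \o g \in bounded_linear.
Proof.
apply/bounded_linearP; split=> [a x y|]; first by rewrite /= !bop_linear.
exists (`|f| * `|g|) => x /=; apply: (le_trans (ler_bop _ _)).
by rewrite -mulrA ler_wpM2l//; exact: ler_bop.
Qed.

Definition bop_comp (f : bop V W) (g : bop U V) : bop U W :=
  Bop (bop_comp_subproof f g).

End Comp.
Notation "f \oc g" := (bop_comp f g) (at level 50, left associativity) : ring_scope.

Record hilbertType (R : realType) := HilbertType {
  hilbert_sort :> completeNormedModType R[i];
  dot : {dot hilbert_sort for Num.conj};
  dot_norm : forall x, `|x| ^+ 2 = dot x x }.
Arguments dot {R h}.

Notation "''B(' H )" := (bop H H) (format "''B(' H )") : type_scope.

Section Operators.
Context {R : realType}.
Local Notation C := R[i].
Variable H : hilbertType R.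
Implicit Types S T : 'B(H).

(* By the Riesz representation theorem the set below is a singleton; the
   default value 0 is never used. *)
Definition adjoint T : 'B(H) :=
  xget (0 : 'B(H)) [set S : 'B(H) | forall x y, dot (T x) y = dot x (S y)].

Definition square_summable (x : nat -> H) :=
  cvgn (series (fun k => `|x k| ^+ 2 : C^o)).

Record l2pair := L2pair {
  l2fst : nat -> H;
  l2snd : nat -> H;
  l2fst_summable : square_summable l2fst;
  l2snd_summable : square_summable l2snd }.

(* T |-> \sum_k <T x_k, y_k> *)
Definition uw_functional T (p : l2pair) : C^o :=
  limn (series (fun k => dot (T (l2fst p k)) (l2snd p k) : C^o)).

Definition uwot := initial_topology (uw_functional : _ -> {ptws l2pair -> C^o}).
HB.instance Definition _ := Topological.on uwot.

Record cstar_subalgebra := CstarSubalgebra {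
  cstar_pred :> {pred 'B(H)};
  cstar_submod : submod_closed cstar_pred;
  cstar_comp : {in cstar_pred &, forall S T, S \oc T \in cstar_pred};
  cstar_adjoint : {in cstar_pred, forall T, adjoint T \in cstar_pred};
  cstar_closed : closed [set` cstar_pred] }.

Definition uw_closure (A : cstar_subalgebra) : set 'B(H) :=
  closure ([set` A] : set uwot).

(* tau is a function on all of B(H), but only its values on N matter. Normal
   means ultraweakly continuous. *)
Record faithful_normal_trace (N : set 'B(H)) (tau : 'B(H) -> C) : Prop := {
  trace_linear : forall a S T, N S -> N T ->
    tau (a *: S + T) = a * tau S + tau T;
  trace_ge0 : forall T, N T -> 0 <= tau (adjoint T \oc T);
  trace_comm : forall S T, N S -> N T -> tau (S \oc T) = tau (T \oc S);
  trace_faithful : forall T, N T -> tau (adjoint T \oc T) = 0 -> T = 0;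
  trace_normal : {within (N : set uwot), continuous (tau : uwot -> C^o)} }.

Definition trace_norm (tau : 'B(H) -> C) T : C := sqrtC (tau (adjoint T \oc T)).

(* The actions are functions on all of B(H), but only their values on N
   matter. *)
Record banach_bimodule (N : set 'B(H)) (X : normedModType C) := BanachBimodule {
  lact : 'B(H) -> X -> X;
  ract : X -> 'B(H) -> X;
  lact_linearl : forall a S T x, N S -> N T ->
    lact (a *: S + T) x = a *: lact S x + lact T x;
  lact_linearr : forall S, N S -> linear (lact S);
  ract_linearl : forall S, N S -> linear (ract^~ S);
  ract_linearr : forall a S T x, N S -> N T ->
    ract x (a *: S + T) = a *: ract x S + ract x T;
  lact_comp : forall S T x, N S -> N T -> lact (S \oc T) x = lact S (lact T x);
  ract_comp : forall S T x, N S -> N T -> ract x (S \oc T) = ract (ract x S) T;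
  lract_comm : forall S T x, N S -> N T ->
    ract (lact S x) T = lact S (ract x T);
  act_bounded : exists K : C, forall S x, N S ->
    `|lact S x| <= K * `|S| * `|x| /\ `|ract x S| <= K * `|x| * `|S| }.

End Operators.


Lemma continuous_initial_ptws (B : topologicalType) (S I : choiceType)
    (V : topologicalType) (h : S -> {ptws I -> V})
    (f : B -> initial_topology h) :
  continuous f <-> forall i, continuous (fun b => h (f b) i).
Proof.
split=> [fc i b|fc].
  apply: (@continuous_comp _ _ _ f (fun s : initial_topology h => h s i)).
    exact: fc.
  apply: (@continuous_comp _ _ _ (h : initial_topology h -> {ptws I -> V})
    (fun g : {ptws I -> V} => g i)); first exact: initial_continuous.
  exact: (@proj_continuous I (fun=> V) i).
apply/continuousP => O [P oP <-].
have hfc : continuous (fun b => h (f b) : {ptws I -> V}).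
  move=> b; apply/cvg_sup => i; move: b.
  apply/(@continuousP _ (initial_topology (fun g : I -> V => g i))).
  move=> _ [D oD <-].
  by move/continuousP : (fc i) => /(_ _ oD).
by move/continuousP : hfc => /(_ _ oP).
Qed.

Section Dual.
Context {R : realType}.
Variable Y : normedModType R[i].

Definition dual := bop Y R[i]^o.
HB.instance Definition _ := NormedModule.on dual.

(* pointwise convergence on the predual Y *)
Definition weakstar :=
  initial_topology ((fun f : dual => f : Y -> R[i]^o) : _ -> {ptws Y -> R[i]^o}).
HB.instance Definition _ := Topological.on weakstar.

End Dual.

Record dual_bimodule (R : realType) (H : hilbertType R) (N : set 'B(H))
    (Y : completeNormedModType R[i]) (X : banach_bimodule N (dual Y)) : Prop := {
  dual_lact : forall S, N S ->
    continuous (lact X S : weakstar Y -> weakstar Y);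
  dual_ract : forall S, N S ->
    continuous ((ract X)^~ S : weakstar Y -> weakstar Y) }.

Record normal_dual_bimodule (R : realType) (H : hilbertType R) (N : set 'B(H))
    (Y : completeNormedModType R[i]) (X : banach_bimodule N (dual Y)) : Prop := {
  normal_dual : dual_bimodule X;
  normal_lact : forall x, {within (N : set (uwot H)),
    continuous ((lact X)^~ x : uwot H -> weakstar Y)};
  normal_ract : forall x, {within (N : set (uwot H)),
    continuous (ract X x : uwot H -> weakstar Y)} }.

Section CstarElements.
Context {R : realType} {H : hilbertType R}.
Variable A : cstar_subalgebra H.

HB.instance Definition _ := GRing.isSubmodClosed.Build R[i] 'B(H) (cstar_pred A)
  (GRing.submod_closed_semi (cstar_submod A)).

Record cstar_elt := CstarElt {
  elt_val :> 'B(H);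
  elt_in : elt_val \in cstar_pred A }.

HB.instance Definition _ := [isSub for elt_val].
HB.instance Definition _ := [Choice of cstar_elt by <:].
HB.instance Definition _ := [SubChoice_isSubLmodule of cstar_elt by <:].

Definition elt_mul (a b : cstar_elt) : cstar_elt :=
  CstarElt (cstar_comp (elt_in a) (elt_in b)).

Definition elt_uwot := initial_topology (elt_val : _ -> uwot H).
HB.instance Definition _ := Topological.on elt_uwot.

End CstarElements.

Section Smooth.
Context {R : realType} {H : hilbertType R}.
Local Notation C := R[i].
Variables (A : cstar_subalgebra H) (tau : 'B(H) -> C).

Definition smooth (V : normedModType C) (f : cstar_elt A -> V) :=
  forall a : cstar_elt A, `|elt_val a| <= 1 ->
  forall e : C, 0 < e -> exists2 d : C, 0 < d &
  forall b : cstar_elt A, `|elt_val b| <= 1 ->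
    trace_norm tau (b - a) < d -> `|f b - f a| < e.

Lemma smooth_submod (V : normedModType C) (a : C) (f g : cstar_elt A -> V) :
  smooth f -> smooth g -> smooth (a *: f + g).
Proof.
move=> fs gs x x1 e e0.
have k0 : 0 < `|a| + 1 by rewrite ltr_wpDl.
have e1 : 0 < e / 2 / (`|a| + 1) by rewrite !divr_gt0.
have e2 : 0 < e / 2 by rewrite divr_gt0.
have [d1 d10 fd] := fs _ x1 _ e1; have [d2 d20 gd] := gs _ x1 _ e2.
have d12 : d1 >=< d2 by apply: real_comparable; exact: gtr0_real.
exists (Order.min d1 d2); first by rewrite comparable_lt_min// d10.
move=> y y1; rewrite comparable_lt_min// => /andP[yd1 yd2].
have -> : (a *: f + g) y - (a *: f + g) x = a *: (f y - f x) + (g y - g x).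
  by rewrite !fctE scalerBr opprD addrACA.
rewrite (le_lt_trans (ler_normD _ _))// [e]splitr ler_ltD ?gd// normrZ.
rewrite (le_trans (_ : _ <= `|a| * (e / 2 / (`|a| + 1))))//.
  by rewrite ler_wpM2l// ltW// fd.
by rewrite mulrCA ler_piMr ?(ltW e2)// ler_pdivrMr// mul1r lerDl.
Qed.

End Smooth.

Section LmodQuot.
Context {K : pzRingType} {V : lmodType K}.
Variable W : submodClosed V.

Definition pred_W : {pred V} := W.
HB.instance Definition _ := GRing.isZmodClosed.Build V pred_W
  (GRing.submod_closedB (submodClosedP W)).

Definition lmod_quot := Quotient.quot pred_W.
HB.instance Definition _ := GRing.Zmodule.on lmod_quot.

Definition lmod_class (v : V) : lmod_quot := \pi_(Quotient.quot pred_W)%qT v.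

Lemma lmod_classP u v : lmod_class u = lmod_class v <-> u - v \in W.
Proof. by rewrite -[_ \in W]/(_ \in pred_W) Quotient.idealrBE; split=> /eqP. Qed.

Lemma lmod_class_surj (c : lmod_quot) : exists v, c = lmod_class v.
Proof. by exists (repr (c : (Quotient.quot pred_W))); rewrite /lmod_class reprK. Qed.

Let lmod_classD u v : lmod_class (u + v) = lmod_class u + lmod_class v.
Proof. exact: pi_addr. Qed.

Let scale (a : K) (c : lmod_quot) := lmod_class (a *: repr (c : (Quotient.quot pred_W))).

Let scaleE a v : scale a (lmod_class v) = lmod_class (a *: v).
Proof.
apply/lmod_classP; rewrite -scalerBr rpredZ//; apply/lmod_classP.
by rewrite /lmod_class reprK.
Qed.

Let scaleA a b c : scale a (scale b c) = scale (a * b) c.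
Proof. by have [v ->] := lmod_class_surj c; rewrite !scaleE scalerA. Qed.

Let scale1 : left_id 1 scale.
Proof. by move=> c; have [v ->] := lmod_class_surj c; rewrite scaleE scale1r. Qed.

Let scaleDr : right_distributive scale +%R.
Proof.
move=> a c d; have [u ->] := lmod_class_surj c.
have [v ->] := lmod_class_surj d.
by rewrite -lmod_classD !scaleE -lmod_classD scalerDr.
Qed.

Let scaleDl c : {morph scale^~ c : a b / a + b}.
Proof.
move=> a b; have [u ->] := lmod_class_surj c.
by rewrite !scaleE -lmod_classD scalerDl.
Qed.

HB.instance Definition _ := GRing.Zmodule_isLmodule.Build K lmod_quot
  scaleA scale1 scaleDr scaleDl.

Lemma lmod_class_linear : linear lmod_class.
Proof. by move=> a u v; rewrite lmod_classD -scaleE. Qed.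

HB.instance Definition _ :=
  GRing.isLinear.Build K V lmod_quot _ lmod_class lmod_class_linear.

End LmodQuot.

(* decorations of the cochain spaces: BL^n_s for Smooth and BL^n_sw for SmoothWeak. *)
Variant kind := Smooth | SmoothWeak.

Section Cochains.
Context {R : realType} {H : hilbertType R}.
Local Notation C := R[i].
Variables (A : cstar_subalgebra H) (tau : 'B(H) -> C).
Variables (Y : completeNormedModType C).
Variable X : banach_bimodule (uw_closure A) (dual Y).
Local Notation cochain n := (('I_n -> cstar_elt A) -> dual Y).
Implicit Types (n : nat) (k : kind).

Definition smooth_elt (x : dual Y) :=
  smooth tau (fun a : cstar_elt A => lact X a x) /\
  smooth tau (fun a : cstar_elt A => ract X x a).

Definition partial n (T : cochain n) (x : 'I_n -> cstar_elt A) (i : 'I_n) :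
  cstar_elt A -> dual Y := fun a => T (dfwith x i a).

Definition multilinear n (T : cochain n) := forall x i, linear (partial T x i).

Definition multibounded n (T : cochain n) :=
  exists K : C, forall x, `|T x| <= K * \prod_i `|elt_val (x i)|.

(* A cochain of degree 0 is a map on the one-point set of functions with
   domain 'I_0, that is, an element of dual Y; its slot-wise conditions are
   void and smoothness is required of that element. *)
Definition BL k n : {pred cochain n} := [pred T | `[<
  [/\ multilinear T,
      multibounded T,
      n = 0%N -> forall x, smooth_elt (T x),
      forall x i, smooth tau (partial T x i) &
      k = SmoothWeak -> forall x i,
        continuous (partial T x i : elt_uwot A -> weakstar Y)] >]].

Arguments BL : clear implicits.

(* multiplies the arguments of indices j and j + 1 (counted from 0) *)
Definition contract n (x : 'I_n.+1 -> cstar_elt A) (j : 'I_n) (i : 'I_n) :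
    cstar_elt A :=
  if (i < j)%N then x (widen_ord (leqnSn n) i)
  else if i == j then elt_mul (x (widen_ord (leqnSn n) j)) (x (lift ord0 j))
  else x (lift ord0 i).

Definition coboundary n (T : cochain n) : cochain n.+1 := fun x =>
  lact X (x ord0) (T (fun i => x (lift ord0 i)))
  + \sum_(j < n) (-1) ^+ j.+1 *: T (contract x j)
  + (-1) ^+ n.+1 *: ract X (T (fun i => x (widen_ord (leqnSn n) i))) (x ord_max).

Definition is_cocycle k n : {pred cochain n} :=
  [pred T | (T \in BL k n) && (coboundary T == 0)].

Arguments is_cocycle : clear implicits.

Lemma cstar_in_closure (a : cstar_elt A) : uw_closure A a.
Proof. by apply: subset_closure; exact: elt_in. Qed.
Arguments cstar_in_closure : clear implicits.

Lemma BLP k n (T : cochain n) : reflect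
  [/\ multilinear T, multibounded T, n = 0%N -> forall x, smooth_elt (T x),
      forall x i, smooth tau (partial T x i) &
      k = SmoothWeak -> forall x i,
        continuous (partial T x i : elt_uwot A -> weakstar Y)]
  (T \in BL k n).
Proof. exact: asboolP. Qed.

Lemma smooth_elt_submod (c : C) (x y : dual Y) :
  smooth_elt x -> smooth_elt y -> smooth_elt (c *: x + y).
Proof.
move=> [lx rx] [ly ry]; split.
  have -> : (fun a : cstar_elt A => lact X a (c *: x + y)) =
      c *: (fun a : cstar_elt A => lact X a x) + (fun a : cstar_elt A => lact X a y).
    by apply/funext => a; rewrite lact_linearr//; exact: cstar_in_closure.
  exact: smooth_submod.
have -> : (fun a : cstar_elt A => ract X (c *: x + y) a) =
    c *: (fun a : cstar_elt A => ract X x a) + (fun a : cstar_elt A => ract X y a).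
  by apply/funext => a; rewrite (ract_linearl _ (cstar_in_closure a)).
exact: smooth_submod.
Qed.

Lemma weakstar_submod (B : topologicalType) (c : C) (f g : B -> dual Y) :
  continuous (f : B -> weakstar Y) -> continuous (g : B -> weakstar Y) ->
  continuous (c *: f + g : B -> weakstar Y).
Proof.
move=> /continuous_initial_ptws fc /continuous_initial_ptws gc.
apply/continuous_initial_ptws => y b.
apply: (@continuousD _ C^o _ (fun b => c *: ((f b : dual Y) y : C^o))
  (fun b => (g b : dual Y) y)); last exact: gc.
by apply: continuousZl_tmp; exact: fc.
Qed.

Lemma BL_submod k n : submod_closed (BL k n).
Proof.
split.
  apply/BLP; split.
  - by move=> x i c a b; rewrite /partial /= scaler0 addr0.
  - by exists 0 => x; rewrite normr0 mul0r.
  - move=> _ x; split.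
    + have -> : (fun a : cstar_elt A => lact X a ((0 : cochain n) x)) = 0.
        apply/funext => a; apply/eqP.
        have := @lact_linearr _ _ _ _ X _ (cstar_in_closure a) (-1) 0 0.
        by rewrite !scaleN1r !addNr => ->.
      by move=> a _ e e0; exists 1 => // b _ _; rewrite subrr normr0.
    + have -> : (fun a : cstar_elt A => ract X ((0 : cochain n) x) a) = 0.
        apply/funext => a; apply/eqP.
        have := @ract_linearl _ _ _ _ X _ (cstar_in_closure a) (-1) 0 0.
        by rewrite !scaleN1r !addNr => ->.
      by move=> a _ e e0; exists 1 => // b _ _; rewrite subrr normr0.
  - by move=> x i a _ e e0; exists 1 => // b _ _; rewrite subrr normr0.
  - by move=> _ x i; exact: cst_continuous.
move=> c S T /BLP[Sl [K SK] Se Ss Sw] /BLP[Tl [L TL] Te Ts Tw].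
have pE x i : partial (c *: S + T) x i = c *: partial S x i + partial T x i by [].
apply/BLP; split.
- move=> x i d a b; rewrite pE !fctE Sl Tl !scalerDr !scalerA (mulrC c d) -!addrA.
  by congr (_ + _); rewrite addrCA.
- exists (`|c| * K + L) => x; rewrite mulrDl -mulrA.
  rewrite (le_trans (ler_normD _ _))// lerD//.
  by rewrite normrZ ler_wpM2l.
- by move=> n0 x; apply: smooth_elt_submod; [exact: Se|exact: Te].
- by move=> x i; rewrite pE; exact: smooth_submod.
- by move=> ks x i; rewrite pE; apply: weakstar_submod; [exact: Sw|exact: Tw].
Qed.

HB.instance Definition _ k n := GRing.isSubmodClosed.Build C (cochain n) (BL k n)
  (GRing.submod_closed_semi (@BL_submod k n)).

Lemma coboundary_linear n : linear (@coboundary n).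
Proof.
move=> c S T; apply/funext => x; rewrite /coboundary !fctE.
rewrite lact_linearr; last exact: cstar_in_closure.
rewrite (ract_linearl _ (cstar_in_closure _)).
have -> : \sum_(j < n) (-1) ^+ j.+1 *: (c *: S + T) (contract x j) =
   c *: \sum_(j < n) (-1) ^+ j.+1 *: S (contract x j) +
   \sum_(j < n) (-1) ^+ j.+1 *: T (contract x j).
  rewrite scaler_sumr -big_split; apply: eq_bigr => j _.
  by rewrite scalerDr !scalerA mulrC.
rewrite [_ ^+ n.+1 *: (_ + _)]scalerDr scalerA (mulrC (_ ^+ n.+1)) -scalerA.
by rewrite [X in X + _ = _]addrACA -scalerDr addrACA -scalerDr.
Qed.

HB.instance Definition _ n :=
  GRing.isLinear.Build C (cochain n) (cochain n.+1) _ (@coboundary n)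
    (@coboundary_linear n).

Lemma is_cocycle_submod k n : submod_closed (is_cocycle k n).
Proof.
split; first by rewrite inE /= rpred0 linear0 eqxx.
move=> c S T /andP[SB /eqP S0] /andP[TB /eqP T0].
rewrite inE /= coboundary_linear S0 T0 scaler0 addr0 eqxx andbT.
by rewrite rpredD// rpredZ.
Qed.

HB.instance Definition _ k n := GRing.isSubmodClosed.Build C (cochain n)
  (is_cocycle k n) (GRing.submod_closed_semi (@is_cocycle_submod k n)).

Record cocycle k n := Cocycle {
  cocycle_val :> cochain n;
  cocycleP : cocycle_val \in is_cocycle k n }.

HB.instance Definition _ k n := [isSub for @cocycle_val k n].
HB.instance Definition _ k n := [Choice of cocycle k n by <:].
HB.instance Definition _ k n := [SubChoice_isSubLmodule of cocycle k n by <:].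

Definition is_coboundary k n : {pred cocycle k n.+1} := [pred z | `[<
  exists2 psi : cochain n, psi \in BL k n & cocycle_val z = coboundary psi >]].

Arguments is_coboundary : clear implicits.

Lemma is_coboundary_submod k n : submod_closed (is_coboundary k n).
Proof.
split; first by apply/asboolP; exists 0; rewrite ?rpred0// linear0.
move=> c S T /asboolP[p pB Sp] /asboolP[q qB Tq].
apply/asboolP; exists (c *: p + q); first by rewrite rpredD// rpredZ.
by rewrite coboundary_linear -Sp -Tq.
Qed.

HB.instance Definition _ k n := GRing.isSubmodClosed.Build C (cocycle k n.+1)
  (is_coboundary k n) (GRing.submod_closed_semi (@is_coboundary_submod k n)).

(* H^n_s and H^n_sw, shifted by one: cohomologyS k n is the group of degree n + 1. *)
Definition cohomologyS k n := lmod_quot (is_coboundary k n).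
HB.instance Definition _ k n := GRing.Lmodule.on (cohomologyS k n).

Definition cohomology_class k n (z : cocycle k n.+1) : cohomologyS k n :=
  lmod_class (is_coboundary k n) z.

Lemma cocycle_incl_subproof n (z : cocycle SmoothWeak n) :
  cocycle_val z \in is_cocycle Smooth n.
Proof.
have /andP[/BLP[l b e s _] d] := cocycleP z.
by apply/andP; split=> //; apply/BLP; split.
Qed.

Definition cocycle_incl n (z : cocycle SmoothWeak n) : cocycle Smooth n :=
  Cocycle (cocycle_incl_subproof z).

End Cochains.

(* Main.v *)
(* Smooth multilinear maps into a dual module are automatically separately
   ultraweak-weak* continuous, so the two cochain complexes coincide. It suffices
   to treat a linear functional f on A that is continuous for the trace norm on
   the unit ball, and to write it as a |-> sum_i <a x_i, y_i> with x, y square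
   summable. By Riesz' theorem in l^2(H) this follows from |f(a)| <= c |a x|.

   The trace itself is, on A, a sum of vector functionals: normality bounds it by
   a vector of l^2(H), and Riesz vectors can be split off one after the other.
   So tau(d^* a^* a d) = |a x|^2 for some x with |x|^2 = tau(d^* d).
   A variational argument on the unit ball makes f a norm limit on A of
   functionals tau(b_k^* a). An approximate polar decomposition inside A writes
   b^* w = sum d^* d with w a contraction, and traciality turns the bound
   |tau(b^* a)| <= delta |a| into |tau(b^* a)| <= sqrt(delta) |a x| + small, where
   |x|^2 <= delta. Summing over the differences b_(k+1) - b_k yields x for f. *)
Require Import Defs.
From HB Require Import structures.
From mathcomp Require Import all_boot all_order all_algebra.
From mathcomp Require Import complex.
From mathcomp Require Import all_classical all_reals all_analysis.
From mathcomp Require Import ring lra.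

Set Implicit Arguments.
Unset Strict Implicit.
Unset Printing Implicit Defensive.

Import Order.TTheory GRing.Theory Num.Theory.
Import numFieldNormedType.Exports.

Local Open Scope classical_set_scope.
Local Open Scope complex_scope.
Local Open Scope ring_scope.

(** * Moduli of complex numbers *)

(** Smoothness alone gives |f(a)| <= K |a|_t + e |a|, and the term e |a| is not controlled by any
    vector. What helps is that, in the presence of a trace, a functional of small norm factors
    through small vectors: the bound |tau(b^* a)| <= delta |a| amounts to tau(|b|) <= delta, and
    with b = w |b| the value tau(b^* a) is a pairing of two vectors built from |b|^(1/2), each of
    squared norm at most delta. Norm errors of order 4^-k thus cost vectors of norm of order 2^-k,
    and these can be summed. The partial isometry w lies in general only in the closure of A,
    whereas f is given on A. Hence the approximation inside A: a contraction w and a finite list of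
    d with b^* w = sum d^* d stand for the partial isometry and for |b|^(1/2). Since A need not
    contain the identity, 1 - w w^* is treated as an operator on H that carries A into A by left
    multiplication. *)

Section ComplexModulus.
Context {R : realType}.
Local Notation C := R[i].
Implicit Types z w : C.

(** Norms take values in [R[i]]; a real-valued copy gives access to square roots, infima and real
    arithmetic. *)
Definition cabs z : R := complex.Re `|z|.

Lemma cabsE z : `|z| = (cabs z)%:C.
Proof. by rewrite /cabs RRe_real. Qed.

Lemma cabs_ge0 z : 0 <= cabs z.
Proof. by rewrite -ler0c -cabsE. Qed.

Lemma cabsM z w : cabs (z * w) = cabs z * cabs w.
Proof. by apply: complexI; rewrite rmorphM /= -!cabsE normrM. Qed.

Lemma cabsD z w : cabs (z + w) <= cabs z + cabs w.
Proof. by rewrite -lecR rmorphD /= -!cabsE ler_normD. Qed.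

Lemma cabsN z : cabs (- z) = cabs z.
Proof. by rewrite /cabs normrN. Qed.

Lemma cabs0 : cabs 0 = 0.
Proof. by rewrite /cabs normr0. Qed.

Lemma cabs_real (r : R) : cabs r%:C = `|r|.
Proof.
by apply: complexI; rewrite -cabsE normc_def /= expr0n addr0 sqrtr_sqr.
Qed.

Lemma cabsJ z : cabs z^*%C = cabs z.
Proof. by apply: complexI; rewrite -!cabsE !normc_def; case: z => a b /=; rewrite sqrrN. Qed.

Lemma cabs_sqr z : cabs z ^+ 2 = complex.Re z ^+ 2 + complex.Im z ^+ 2.
Proof. by apply: complexI; rewrite rmorphXn /= -cabsE add_Re2_Im2. Qed.

Lemma Re_le_cabs z : complex.Re z <= cabs z.
Proof.
have [z0|z0] := lerP (complex.Re z) 0; first exact: le_trans (cabs_ge0 _).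
have h : complex.Re z ^+ 2 <= cabs z ^+ 2 by rewrite cabs_sqr lerDl sqr_ge0.
by move: h; rewrite ler_pXn2r// nnegrE ?cabs_ge0// ltW.
Qed.

Lemma cabs_i : cabs 'i%C = 1.
Proof. by apply: complexI; rewrite -cabsE normc_def /= expr0n add0r expr1n sqrtr1. Qed.

Lemma cabs_Re_Im z : cabs z <= `|complex.Re z| + `|complex.Im z|.
Proof.
rewrite [X in cabs X]complexE (le_trans (cabsD _ _))// cabs_real lerD2l cabsM cabs_real.
by rewrite cabs_i mul1r.
Qed.

Lemma norm_Re_le z : `|complex.Re z| <= cabs z.
Proof.
rewrite ler_norml Re_le_cabs andbT lerNl.
by have := Re_le_cabs (- z); rewrite cabsN; case: z.
Qed.

Lemma norm_Im_le z : `|complex.Im z| <= cabs z.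
Proof.
have := norm_Re_le (z * 'i%C); rewrite ReiNIm normrN cabsM.
by rewrite cabs_i mulr1.
Qed.

Lemma cabs_eq0 z : cabs z = 0 -> z = 0.
Proof. by move=> z0; apply/eqP; rewrite -normr_eq0 cabsE z0. Qed.

Lemma ReD z w : complex.Re (z + w) = complex.Re z + complex.Re w.
Proof. by case: z => ? ?; case: w. Qed.

Lemma ImD z w : complex.Im (z + w) = complex.Im z + complex.Im w.
Proof. by case: z => ? ?; case: w. Qed.

Lemma ReN z : complex.Re (- z) = - complex.Re z.
Proof. by case: z. Qed.

Lemma ReB z w : complex.Re (z - w) = complex.Re z - complex.Re w.
Proof. by rewrite ReD ReN. Qed.

Lemma ReJ z : complex.Re z^*%C = complex.Re z.
Proof. by case: z. Qed.

Lemma ReZ (r : R) z : complex.Re (r%:C * z) = r * complex.Re z.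
Proof. by case: z => a b; rewrite /= mul0r subr0. Qed.

Lemma ge0_Re z : 0 <= z -> 0 <= complex.Re z /\ z = (complex.Re z)%:C.
Proof.
by move=> z0; rewrite RRe_real ?ger0_real//; split=> //; rewrite -ler0c RRe_real ?ger0_real.
Qed.

(** Rotating the argument by [u] upgrades a bound on the real part of a linear functional to one on
    its modulus. *)
Lemma phase z : exists2 u : C, cabs u = 1 & u * z = (cabs z)%:C.
Proof.
have [->|z0] := eqVneq z 0.
  by exists 1; rewrite ?mulr0 ?cabs0//; rewrite /cabs normr1.
have nz : cabs z != 0 by apply: contra_neq z0; exact: cabs_eq0.
exists ((cabs z)^-1%:C * z^*%C).
  by rewrite cabsM cabsJ cabs_real ger0_norm ?invr_ge0 ?cabs_ge0// mulVf.
rewrite -mulrA [z^*%C * z]mulrC -sqr_normc cabsE -!rmorphXn -rmorphM /=.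
by rewrite expr2 mulKf.
Qed.

End ComplexModulus.

Section RealLemmas.
Context {R : realType}.

(** The case [a = 0] is kept because the quadratics come from forms that may vanish on nonzero
    vectors; there an affine function bounded below has slope zero. *)
Lemma discr_le (a b c : R) : 0 <= a -> 0 <= c ->
  (forall t, 0 <= a * t ^+ 2 + 2 * b * t + c) -> b ^+ 2 <= a * c.
Proof.
move=> a0 c0 h; have [a00|an0] := eqVneq a 0; last first.
  have a1 : 0 < a by rewrite lt_neqAle eq_sym an0.
  have := h (- b / a).
  have -> : a * (- b / a) ^+ 2 + 2 * b * (- b / a) + c = (a * c - b ^+ 2) / a by field.
  by rewrite pmulr_lge0 ?invr_gt0// subr_ge0.
have [->|b0] := eqVneq b 0; first by rewrite expr0n mulr_ge0.
have := h (- (c + 1) / (2 * b)).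
rewrite a00 mul0r add0r.
have -> : 2 * b * (- (c + 1) / (2 * b)) + c = -1 by field.
by rewrite ler0N1.
Qed.

Lemma geom_small (c e : R) : 0 < e -> exists n, c * 2^-1 ^+ n < e.
Proof.
move=> e0.
have /cvgrPdist_lt/(_ e e0) [N _ h] : (fun n => c * 2^-1 ^+ n) @ \oo --> (0 : R).
  by rewrite -[0](mulr0 c); apply: cvgMr; apply: cvg_expr; rewrite ger0_norm//; lra.
exists N; have := h N (leqnn N); rewrite /= sub0r normrN.
exact/le_lt_trans/ler_norm.
Qed.

Lemma le_geom0 (x c : R) : (forall n, x <= c * 2^-1 ^+ n) -> x <= 0.
Proof.
move=> h; rewrite leNgt; apply/negP => x0.
have [n] := geom_small c x0; rewrite ltNge => /negP; apply; exact: h.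
Qed.

End RealLemmas.

(** * Semi-inner products and Riesz' theorem *)

Section SemiInnerProduct.
Context {R : realType}.
Local Notation C := R[i].

(** Definiteness is not asked for: besides [dot], the structure covers pulled-back forms and the
    forms of positive functionals on A, whose null vectors are never divided out. *)
Record semiip (V : lmodType C) := SemiIP {
  sip :> V -> V -> C;
  sip_linearl : forall a x y z, sip (a *: x + y) z = a * sip x z + sip y z;
  sip_linearr : forall a x y z, sip x (a *: y + z) = a^*%C * sip x y + sip x z;
  sip_ge0 : forall x, 0 <= sip x x }.

Variables (V : lmodType C) (s : semiip V).
Implicit Types x y z : V.

Definition sqn x : R := complex.Re (s x x).
Definition sn x : R := Num.sqrt (sqn x).

Lemma sip0l z : s 0 z = 0.
Proof. by have := sip_linearl s (-1) 0 0 z; rewrite scaler0 addr0 mulN1r addNr. Qed.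

Lemma sip0r z : s z 0 = 0.
Proof. by have := sip_linearr s (-1) z 0 0; rewrite scaler0 addr0 rmorphN1 mulN1r addNr. Qed.

Lemma sipDl x y z : s (x + y) z = s x z + s y z.
Proof. by rewrite -{1}[x]scale1r sip_linearl mul1r. Qed.

Lemma sipDr x y z : s x (y + z) = s x y + s x z.
Proof. by rewrite -{1}[y]scale1r sip_linearr rmorph1 mul1r. Qed.

Lemma sipZl a x z : s (a *: x) z = a * s x z.
Proof. by rewrite -[a *: x]addr0 sip_linearl sip0l addr0. Qed.

Lemma sipZr a x z : s x (a *: z) = a^*%C * s x z.
Proof. by rewrite -[a *: z]addr0 sip_linearr sip0r addr0. Qed.

Lemma sipNl x z : s (- x) z = - s x z.
Proof. by rewrite -scaleN1r sipZl mulN1r. Qed.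

Lemma sipNr x z : s x (- z) = - s x z.
Proof. by rewrite -scaleN1r sipZr rmorphN1 mulN1r. Qed.

Lemma sipBl x y z : s (x - y) z = s x z - s y z.
Proof. by rewrite sipDl sipNl. Qed.

Lemma sipBr x y z : s z (x - y) = s z x - s z y.
Proof. by rewrite sipDr sipNr. Qed.

Lemma sqnE x : s x x = (sqn x)%:C.
Proof. by have [] := ge0_Re (sip_ge0 s x). Qed.

Lemma sqn_ge0 x : 0 <= sqn x.
Proof. by have [] := ge0_Re (sip_ge0 s x). Qed.

Lemma sn_ge0 x : 0 <= sn x.
Proof. exact: sqrtr_ge0. Qed.

Lemma sn_sqr x : sn x ^+ 2 = sqn x.
Proof. by rewrite sqr_sqrtr// sqn_ge0. Qed.

(* Hermitian symmetry follows from positivity by polarization. *)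
Lemma sip_herm x y : s y x = (s x y)^*%C.
Proof.
have r z : complex.Im (s z z) = 0 by rewrite sqnE.
have := r (x + y); rewrite !(sipDl, sipDr) !ImD !r.
have := r (x + 'i%C *: y); rewrite !(sipDl, sipDr, sipZl, sipZr) !ImD !r.
case: (s x y) => a b; case: (s y x) => c d; case: (s y y) (r y) => e f /= -> *.
by congr (_ +i* _); lra.
Qed.

Lemma ReC x y : complex.Re (s y x) = complex.Re (s x y).
Proof. by rewrite sip_herm ReJ. Qed.

Lemma sqnD x y : sqn (x + y) = sqn x + 2 * complex.Re (s x y) + sqn y.
Proof. by rewrite /sqn !(sipDl, sipDr) !ReD (ReC x y); lra. Qed.

Lemma sqnZ a x : sqn (a *: x) = cabs a ^+ 2 * sqn x.
Proof.
rewrite /sqn sipZl sipZr mulrA sqnE -sqr_normc cabsE -rmorphXn -rmorphM.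
by [].
Qed.

Lemma sqnN x : sqn (- x) = sqn x.
Proof. by rewrite /sqn sipNl sipNr opprK. Qed.

Lemma sqnB x y : sqn (x - y) = sqn x - 2 * complex.Re (s x y) + sqn y.
Proof. by rewrite sqnD sqnN sipNr ReN; lra. Qed.

Lemma snN x : sn (- x) = sn x.
Proof. by rewrite /sn sqnN. Qed.

Lemma snZ a x : sn (a *: x) = cabs a * sn x.
Proof. by rewrite /sn sqnZ sqrtrM ?sqr_ge0// sqrtr_sqr ger0_norm ?cabs_ge0. Qed.

Lemma Re_sip_le x y : complex.Re (s x y) <= sn x * sn y.
Proof.
have [h|h] := lerP (complex.Re (s x y)) 0.
  by rewrite (le_trans h)// mulr_ge0// sn_ge0.
rewrite -(@ler_pXn2r _ 2)// ?nnegrE ?mulr_ge0 ?sn_ge0 ?(ltW h)//.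
rewrite exprMn !sn_sqr; apply: discr_le; rewrite ?sqn_ge0// => t.
have := sqn_ge0 (t%:C *: x + y).
rewrite sqnD sqnZ cabs_real sipZl ReZ real_normK ?num_real//; nra.
Qed.

Lemma sip_le x y : cabs (s x y) <= sn x * sn y.
Proof.
have [u u1 h] := phase (s x y).
have := Re_sip_le (u *: x) y.
by rewrite sipZl h snZ u1 mul1r.
Qed.

Lemma snD x y : sn (x + y) <= sn x + sn y.
Proof.
rewrite -(@ler_pXn2r _ 2)// ?nnegrE ?addr_ge0 ?sn_ge0//.
rewrite sqrrD !sn_sqr sqnD lerD2r lerD2l.
have := Re_sip_le x y; lra.
Qed.

Lemma snB x y : sn (x - y) <= sn x + sn y.
Proof. by rewrite (le_trans (snD _ _))// snN. Qed.

(** Completeness is replaced by a near-minimiser: [J] is bounded below by [- M ^+ 2], and for [v]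
    within [e ^+ 2] of its infimum the quadratic J(v - t x) - J(v) + e^2 in t is nonnegative, so its
    discriminant bounds the real part of [F x - s x v]. *)
Lemma riesz_approx (F : V -> C) (M e : R) :
  (forall a x y, F (a *: x + y) = a * F x + F y) ->
  (forall x, cabs (F x) <= M * sn x) -> 0 < e ->
  exists v, forall x, cabs (F x - s x v) <= e * sn x.
Proof.
move=> Fl FM e0; pose J x := sqn x - 2 * complex.Re (F x).
have FZ a x : F (a *: x) = a * F x.
  have F0 : F 0 = 0 by have := Fl (-1) 0 0; rewrite scaler0 addr0 mulN1r addNr.
  by rewrite -[a *: x]addr0 Fl F0 addr0.
have Jlb x : - M ^+ 2 <= J x.
  rewrite /J -sn_sqr.
  have := le_trans (Re_le_cabs _) (FM x).
  have := sqr_ge0 (sn x - M); nra.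
have hJ : has_inf (range J).
  by split; [exists (J 0), 0|exists (- M ^+ 2) => _ [x _ <-]].
have [_ [v _ <-] vJ] := inf_adherent (exprn_gt0 2 e0) hJ.
exists v; suff h x : complex.Re (F x - s x v) <= e * sn x.
  move=> x; have [u u1 ux] := phase (F x - s x v).
  have := h (u *: x); rewrite FZ sipZl -mulrBr ux snZ u1 mul1r.
  exact.
have [h|h] := lerP (complex.Re (F x - s x v)) 0.
  by rewrite (le_trans h)// mulr_ge0 ?sn_ge0// ltW.
rewrite -(@ler_pXn2r _ 2)// ?nnegrE ?mulr_ge0 ?sn_ge0 ?(ltW h)// ?(ltW e0)//.
rewrite exprMn sn_sqr mulrC; apply: discr_le; rewrite ?sqn_ge0 ?sqr_ge0// => t.
have : inf (range J) <= J ((- t)%:C *: x + v).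
  by apply: ge_inf; [case: hJ|exists ((- t)%:C *: x + v)].
rewrite /J in vJ *; rewrite Fl sqnD sqnZ sipZl !ReD ReN !ReZ cabs_real real_normK ?num_real//.
nra.
Qed.

(* Only sequences that are Cauchy at a geometric rate are tested; they suffice
   for completeness. *)
Definition ip_complete := forall u : nat -> V,
  (forall n m, (n <= m)%N -> sn (u n - u m) <= 2^-1 ^+ n) ->
  exists l, forall n, sn (u n - l) <= 2^-1 ^+ n.

End SemiInnerProduct.

Section Pullback.
Context {R : realType}.
Variables (V W : lmodType R[i]) (s : semiip W) (j : V -> W).
Hypothesis j_linear : linear j.

Definition pullback : semiip V.
Proof.
apply: (@SemiIP _ _ (fun x y => s (j x) (j y))) => [a x y z|a x y z|x].
- by rewrite j_linear sip_linearl.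
- by rewrite j_linear sip_linearr.
- exact: sip_ge0.
Defined.

(** The approximate Riesz vectors live in [V], which need not be complete; their images are Cauchy
    because the squared norm of [j (e n) - j (e m)] is a difference of two approximation errors. The
    second conclusion puts [y] in the closure of the image, which later allows a Riesz vector to be
    replaced by vectors of the orbit. *)
Lemma riesz (F : V -> R[i]) (M : R) : ip_complete s ->
  (forall a x y, F (a *: x + y) = a * F x + F y) ->
  (forall x, cabs (F x) <= M * sn s (j x)) ->
  exists y, (forall x, F x = s (j x) y) /\
    forall e, 0 < e -> exists v, sn s (j v - y) <= e.
Proof.
move=> cs Fl FM.
have jB x y : j (x - y) = j x - j y.
  by rewrite -[x - y]addrC -scaleN1r j_linear scaleN1r addrC.
pose g n : R := 2^-1 ^+ n.
have g0 n : 0 < g n by rewrite exprn_gt0.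
have gS n : g n.+1 = g n / 2 by rewrite /g exprS mulrC.
have ga n : exists v, forall x, cabs (F x - s (j x) (j v)) <= g n.+1 * sn s (j x).
  exact: (@riesz_approx _ _ pullback F M _ Fl FM (g0 n.+1)).
have [e eP] := choice ga.
have [n m nm|y yP] := cs (j \o e).
  have gm : g m <= g n by rewrite /g ler_wiXn2l//; lra.
  have h := eP n (e n - e m); have h' := eP m (e n - e m).
  rewrite /=; set x := j (e n) - j (e m).
  rewrite jB -/x in h h'.
  have : sn s x ^+ 2 <= (g n.+1 + g m.+1) * sn s x.
    rewrite sn_sqr {1}/sqn {2}/x sipBr.
    have -> : s x (j (e n)) - s x (j (e m)) =
      (F (e n - e m) - s x (j (e m))) - (F (e n - e m) - s x (j (e n))) by ring.
    rewrite (le_trans (Re_le_cabs _))// (le_trans (cabsD _ _))// cabsN mulrDl addrC.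
    exact: lerD.
  have := sn_ge0 s x; rewrite le_eqVlt => /predU1P[<- _|x0]; first exact/ltW/g0.
  rewrite expr2 ler_pM2r// => /le_trans; apply; rewrite !gS -/(g n); lra.
exists y; split=> [x|d d0]; last first.
  have [n] := geom_small 1 d0; rewrite mul1r => nd; exists (e n).
  exact: le_trans (yP n) (ltW nd).
apply/eqP; rewrite -subr_eq0; apply/eqP/cabs_eq0/eqP; rewrite eq_le cabs_ge0 andbT.
apply: (@le_geom0 _ _ (2 * sn s (j x))) => n.
have -> : F x - s (j x) y = (F x - s (j x) (j (e n))) + s (j x) (j (e n) - y).
  by rewrite sipBr; ring.
rewrite (le_trans (cabsD _ _))//.
have h := le_trans (sip_le s (j x) (j (e n) - y)) (ler_wpM2l (sn_ge0 s _) (yP n)).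
have := eP n x; have := sn_ge0 s (j x); have := g0 n.
rewrite gS /g in h *; nra.
Qed.

End Pullback.

(** * Hilbert spaces and adjoints *)

Section RealNorm.
Context {R : realType}.
Local Notation C := R[i].
Variable V : normedModType C.
Implicit Types x y : V.

Definition nrm x : R := complex.Re `|x|.

Lemma nrmE x : `|x| = (nrm x)%:C.
Proof. by rewrite /nrm RRe_real. Qed.

Lemma nrm_ge0 x : 0 <= nrm x.
Proof. by rewrite -ler0c -nrmE. Qed.

Lemma nrmD x y : nrm (x + y) <= nrm x + nrm y.
Proof. by rewrite -lecR rmorphD /= -!nrmE ler_normD. Qed.

Lemma nrmN x : nrm (- x) = nrm x.
Proof. by rewrite /nrm normrN. Qed.

Lemma nrmZ (a : C) x : nrm (a *: x) = cabs a * nrm x.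
Proof. by apply: complexI; rewrite -nrmE normrZ nrmE cabsE rmorphM. Qed.

Lemma nrm0 : nrm 0 = 0.
Proof. by rewrite /nrm normr0. Qed.

End RealNorm.

Section BoundedOperators.
Context {R : realType}.
Local Notation C := R[i].

Lemma nrm_bop (U V : normedModType C) (f : bop U V) x : nrm (f x) <= nrm f * nrm x.
Proof. by rewrite -lecR rmorphM /= -!nrmE; exact: ler_bop. Qed.

Lemma nrm_bop_le (U V : normedModType C) (f : bop U V) (c : R) :
  0 <= c -> (forall x, nrm (f x) <= c * nrm x) -> nrm f <= c.
Proof.
move=> c0 h; rewrite -lecR -nrmE bop_normE lecR; apply: ge_sup.
  by exists (complex.Re `|f 0|), 0 => //=; rewrite normr0.
move=> _ [x /= x1 <-]; apply: (le_trans (h x)).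
by rewrite ler_piMr// -lecR -nrmE.
Qed.

Lemma bopD (U V : normedModType C) (f : bop U V) x y : f (x + y) = f x + f y.
Proof. by have := bop_linear f 1 x y; rewrite !scale1r. Qed.

Lemma bopN (U V : normedModType C) (f : bop U V) x : f (- x) = - f x.
Proof. by rewrite -scaleN1r bopZ scaleN1r. Qed.

Lemma bopB (U V : normedModType C) (f : bop U V) x y : f (x - y) = f x - f y.
Proof. by rewrite bopD bopN. Qed.

Lemma bop_eq (U V : normedModType C) (f g : bop U V) : f =1 g -> f = g.
Proof. by move=> h; apply/val_inj/funext. Qed.

End BoundedOperators.

Section HilbertSpace.
Context {R : realType}.
Local Notation C := R[i].
Variable H : hilbertType R.
Implicit Types (x y z : H) (S T : 'B(H)).

Definition dotip : semiip H.
Proof.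
apply: (@SemiIP _ _ (fun x y => dot x y)) => [a x y z|a x y z|x].
- by rewrite linearPl.
- by rewrite linearPr.
- by rewrite -dot_norm exprn_ge0.
Defined.

Lemma sn_dotip x : sn dotip x = nrm x.
Proof.
rewrite /sn /sqn /= -dot_norm nrmE -rmorphXn /=.
by rewrite sqrtr_sqr ger0_norm ?nrm_ge0.
Qed.

Lemma sqn_dotip x : sqn dotip x = nrm x ^+ 2.
Proof. by rewrite -sn_sqr sn_dotip. Qed.

Lemma dotip_complete : ip_complete dotip.
Proof.
move=> u uP.
have g0 n : 0 < (2^-1 ^+ n : R) by rewrite exprn_gt0.
have e_real (e : C) : 0 < e -> 0 < complex.Re e /\ e = (complex.Re e)%:C.
  move=> e0; have [_ ee] := ge0_Re (ltW e0); split=> //.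
  by rewrite -ltcR -ee.
have cu : cvgn u.
  apply/cauchy_cvgP/cauchy_exP => e /e_real[e0 ->].
  have [n] := geom_small 1 e0; rewrite mul1r => ne.
  exists (u n); exists n => // m /= nm.
  by rewrite -ball_normE /= nrmE ltcR -sn_dotip (le_lt_trans (uP _ _ nm)).
exists (limn u) => n; apply/ler_addgt0Pr => e e0.
have /cvgrPdist_lt/(_ (e%:C)) := cu.
rewrite ltcR => /(_ e0)[N _ h].
have := h (maxn N n) (leq_maxl _ _); rewrite /= nrmE ltcR => h1.
rewrite -(subrK (u (maxn N n)) (u n)) -addrA (le_trans (snD _ _ _))// lerD ?uP ?leq_maxr//.
by rewrite sn_dotip -nrmN opprB ltW.
Qed.

Lemma dot_cabs_le x y : cabs (dot x y) <= nrm x * nrm y.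
Proof. by have := sip_le dotip x y; rewrite !sn_dotip. Qed.

Lemma dot_uniq x y : (forall z, dot z x = dot z y) -> x = y.
Proof.
move=> h; apply/eqP; rewrite -subr_eq0 -normr_eq0 nrmE.
have : sqn dotip (x - y) = 0 by rewrite /sqn sipBr /= h subrr.
by rewrite sqn_dotip => /eqP; rewrite sqrf_eq0 => /eqP ->.
Qed.

Lemma adjoint_exists T : exists S : 'B(H), forall x y, dot (T x) y = dot x (S y).
Proof.
have h y : exists v, forall x, dot (T x) y = dot x v.
  have [] := @riesz _ _ _ dotip idfun (fun _ _ _ => erefl) (fun x => dot (T x) y)
    (nrm T * nrm y) dotip_complete.
  - by move=> a x z; rewrite bop_linear linearPl.
  - move=> x; rewrite sn_dotip (le_trans (dot_cabs_le _ _))//.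
    by rewrite mulrAC ler_wpM2r ?nrm_ge0 ?nrm_bop.
  - by move=> v [vP _]; exists v.
have [S SP] := choice h.
have Sl : linear S.
  move=> a x y; apply: dot_uniq => z.
  by rewrite -SP !linearPr /= !SP.
have Sb x : nrm (S x) <= nrm T * nrm x.
  have [->|s0] := eqVneq (nrm (S x)) 0; first by rewrite mulr_ge0 ?nrm_ge0.
  have s1 : 0 < nrm (S x) by rewrite lt_neqAle eq_sym s0 nrm_ge0.
  rewrite -(ler_pM2l s1) -expr2 -sqn_dotip /sqn /= -SP.
  rewrite (le_trans (Re_le_cabs _))// (le_trans (dot_cabs_le _ _))//.
  rewrite mulrA ler_wpM2r ?nrm_ge0// mulrC; exact: nrm_bop.
have Sbl : S \in bounded_linear.
  apply/bounded_linearP; split=> //; exists (nrm T)%:C => x.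
  by rewrite !nrmE -rmorphM lecR.
by exists (Bop Sbl).
Qed.

Lemma adjointE T x y : dot (T x) y = dot x (adjoint T y).
Proof. by have /xgetPex := adjoint_exists T => /(_ 0); apply. Qed.

Lemma adjointEr T x y : dot x (T y) = dot (adjoint T x) y.
Proof.
have := sip_herm dotip (T y) x; have := sip_herm dotip y (adjoint T x).
by rewrite /= => -> ->; rewrite adjointE.
Qed.

Lemma adjoint_uniq S T : (forall x y, dot (T x) y = dot x (S y)) -> adjoint T = S.
Proof. by move=> h; apply: bop_eq => y; apply: dot_uniq => x; rewrite -adjointE h. Qed.

Lemma adjointP (a : C) S T : adjoint (a *: S + T) = a^*%C *: adjoint S + adjoint T.
Proof.
apply: adjoint_uniq => x y; rewrite linearPl linearPr /= !adjointE.
by congr (_ * _ + _); exact: esym (conjcK _).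
Qed.

Lemma adjointM S T : adjoint (S \oc T) = adjoint T \oc adjoint S.
Proof. by apply: adjoint_uniq => x y; rewrite /= adjointE (adjointE T). Qed.

Lemma adjointK T : adjoint (adjoint T) = T.
Proof. by apply: adjoint_uniq => x y; rewrite -adjointEr. Qed.

Lemma adjoint_le1 T : nrm T <= 1 -> forall x, nrm (adjoint T x) <= nrm x.
Proof.
move=> T1 x; set y := adjoint T x.
have [->|s0] := eqVneq (nrm y) 0; first by rewrite nrm_ge0.
have s1 : 0 < nrm y by rewrite lt_neqAle eq_sym s0 nrm_ge0.
rewrite -(ler_pM2l s1) -expr2 -sqn_dotip /sqn /= /y -adjointE.
rewrite (le_trans (Re_le_cabs _))// (le_trans (dot_cabs_le _ _))//.
rewrite ler_wpM2r ?nrm_ge0// (le_trans (nrm_bop _ _))// ler_piMl ?nrm_ge0//.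
Qed.

End HilbertSpace.

(** * Square summable sequences *)

Section ComplexSeries.
Context {R : realType}.
Local Notation C := R[i].

Lemma complex_cvg (a b : nat -> R) (l m : R) :
  a @ \oo --> l -> b @ \oo --> m ->
  (fun n => (a n +i* b n : C^o)) @ \oo --> (l +i* m : C^o).
Proof.
move=> al bm; apply/cvgrPdist_lt => e e0.
have [_ ee] := ge0_Re (ltW e0).
have {}e0 : 0 < complex.Re e by rewrite -ltcR -ee.
rewrite ee; move: (complex.Re e) e0 => {ee} {}e e0.
have e2 : 0 < e / 2 by rewrite divr_gt0.
have /cvgrPdist_lt/(_ _ e2) h1 := al; have /cvgrPdist_lt/(_ _ e2) h2 := bm.
near=> n; rewrite cabsE ltcR.
have h1n : `|l - a n| < e / 2 by near: n.
have h2n : `|m - b n| < e / 2 by near: n.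
by rewrite (le_lt_trans (cabs_Re_Im _))//= [e]splitr ltrD.
Unshelve. all: by end_near. Qed.

Lemma Re_series (z : nat -> C) n :
  complex.Re (series (z : nat -> C^o) n) = series (fun i => complex.Re (z i)) n.
Proof.
rewrite /series /=; elim: n => [|n ih]; first by rewrite !big_geq.
by rewrite !big_nat_recr//= ReD ih.
Qed.

Lemma Im_series (z : nat -> C) n :
  complex.Im (series (z : nat -> C^o) n) = series (fun i => complex.Im (z i)) n.
Proof.
rewrite /series /=; elim: n => [|n ih]; first by rewrite !big_geq.
by rewrite !big_nat_recr//= ImD ih.
Qed.

Lemma cvg_series_dominated (u v : nat -> R) : (forall n, `|u n| <= v n) ->
  (\sum_(i <oo) (v i)%:E < +oo)%E -> cvgn (series u).
Proof.
move=> uv vs; apply: normed_cvg.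
have v0 n : 0 <= v n := le_trans (normr_ge0 _) (uv n).
apply: (@series_le_cvg _ _ v) => //; first by move=> n /=.
apply: nondecreasing_is_cvgn.
  by apply/nondecreasing_series => n _ _.
have fv : (\sum_(i <oo) (v i)%:E)%E \is a fin_num.
  by rewrite ge0_fin_numE//; apply: nneseries_ge0 => *; rewrite lee_fin.
exists (fine (\sum_(i <oo) (v i)%:E)%E) => _ [n _ <-] /=.
rewrite -lee_fin fineK// /series /= -sumEFin.
by apply: nneseries_lim_ge => *; rewrite lee_fin.
Qed.

Lemma cvg_complex_series_dominated (z : nat -> C) (v : nat -> R) :
  (forall n, cabs (z n) <= v n) -> (\sum_(i <oo) (v i)%:E < +oo)%E ->
  cvgn (series (z : nat -> C^o)).
Proof.
move=> zv vs.
have re : cvgn (series (fun i => complex.Re (z i))).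
  by apply: cvg_series_dominated vs => n; exact: le_trans (norm_Re_le _) (zv n).
have im : cvgn (series (fun i => complex.Im (z i))).
  by apply: cvg_series_dominated vs => n; exact: le_trans (norm_Im_le _) (zv n).
suff h : series (z : nat -> C^o) @ \oo -->
    (limn (series (fun i => complex.Re (z i))) +i*
     limn (series (fun i => complex.Im (z i))) : C^o) by exact: cvgP h.
have -> : series (z : nat -> C^o) = (fun n => (series (fun i => complex.Re (z i)) n
    +i* series (fun i => complex.Im (z i)) n : C^o)).
  by apply/funext => n; rewrite -Re_series -Im_series; case: (series _ n).
exact: complex_cvg.
Qed.

Lemma cvg_series_real (v : nat -> R) (l : R) : series v @ \oo --> l ->
  series (fun n => (v n)%:C : C^o) @ \oo --> (l%:C : C^o).
Proof.
move=> vl.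
have -> : series (fun n => (v n)%:C : C^o) = (fun n => (series v n +i* 0 : C^o)).
  by apply/funext => n; rewrite /series /= -(rmorph_sum (real_complex R)).
by apply: complex_cvg => //; exact: cvg_cst.
Qed.

Lemma cvg_series_nneseries (v : nat -> R) : (forall n, 0 <= v n) ->
  (\sum_(i <oo) (v i)%:E < +oo)%E ->
  series v @ \oo --> fine (\sum_(i <oo) (v i)%:E)%E.
Proof.
move=> v0 vs.
have cv : cvgn (series v) by apply: cvg_series_dominated vs => n; rewrite ger0_norm.
suff -> : (\sum_(i <oo) (v i)%:E)%E = (limn (series v))%:E by [].
rewrite -EFin_lim//; congr (limn _); apply/funext => n.
by rewrite /= /series /= sumEFin.
Qed.

Lemma nneseries_cvg_real (v : nat -> R) (l : R) : (forall n, 0 <= v n) ->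
  series v @ \oo --> l -> (\sum_(i <oo) (v i)%:E)%E = l%:E.
Proof.
move=> v0 vl; rewrite -(cvg_lim _ vl)// -EFin_lim; last exact: cvgP vl.
by congr (limn _); apply/funext => n; rewrite /= /series /= sumEFin.
Qed.

End ComplexSeries.

Section SquareSummable.
Context {R : realType}.
Local Notation C := R[i].
Variable H : hilbertType R.

(** In the extended reals, sums can be compared, added and rearranged before their finiteness is
    known. *)
Definition nn_sum (x : nat -> H) : \bar R := (\sum_(i <oo) (nrm (x i) ^+ 2)%:E)%E.

Definition ell2_pred : {pred nat -> H} := [pred x | (nn_sum x < +oo)%E].

Let term_ge0 (x : nat -> H) n : (0 <= (nrm (x n) ^+ 2)%:E)%E.
Proof. by rewrite lee_fin sqr_ge0. Qed.

Lemma nn_sum_ge0 x : (0 <= nn_sum x)%E.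
Proof. exact: nneseries_ge0. Qed.

Lemma nn_sum_bound (x : nat -> H) (c : R) (y : nat -> H) :
  0 <= c -> (forall n, nrm (x n) <= c * nrm (y n)) ->
  (nn_sum x <= (c ^+ 2)%:E * nn_sum y)%E.
Proof.
move=> c0 xy; rewrite -nneseriesZl//; apply: lee_nneseries => // n _.
rewrite -EFinM lee_fin -exprMn ler_pXn2r// nnegrE ?nrm_ge0//.
by rewrite mulr_ge0 ?nrm_ge0.
Qed.

Lemma ell2_submod : submod_closed ell2_pred.
Proof.
split.
  rewrite inE /nn_sum eseries0 ?ltry// => n _ _.
  by rewrite /= nrm0 expr0n.
move=> a x y; rewrite !inE => xs ys.
have h n : nrm (a *: x n + y n) ^+ 2 <=
    2 * cabs a ^+ 2 * nrm (x n) ^+ 2 + 2 * nrm (y n) ^+ 2.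
  have := nrmD (a *: x n) (y n); rewrite nrmZ => hn.
  have p0 := nrm_ge0 (a *: x n + y n); have r0 := nrm_ge0 (y n).
  have q0 : 0 <= cabs a * nrm (x n) by rewrite mulr_ge0 ?nrm_ge0 ?cabs_ge0.
  rewrite -mulrA -exprMn; move: hn q0 r0 p0.
  move: (nrm (_ + _)) (cabs a * _) (nrm (y n)) => p q r hn q0 r0 p0.
  have := sqr_ge0 (q - r); nra.
have cb : 0 <= 2 * cabs a ^+ 2 by rewrite mulr_ge0 ?sqr_ge0.
have le : (nn_sum (a *: x + y)%R <=
    (2 * cabs a ^+ 2)%R%:E * nn_sum x + 2%:E * nn_sum y)%E.
  rewrite -!nneseriesZl// -nneseriesD//; last 2 first.
    by move=> *; rewrite -EFinM lee_fin mulr_ge0 ?sqr_ge0.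
    by move=> *; rewrite -EFinM lee_fin mulr_ge0 ?sqr_ge0.
  by apply: lee_nneseries => // n _; rewrite -!EFinM -EFinD lee_fin; exact: h.
apply: (le_lt_trans le).
have xf : nn_sum x \is a fin_num by rewrite ge0_fin_numE// nn_sum_ge0.
have yf : nn_sum y \is a fin_num by rewrite ge0_fin_numE// nn_sum_ge0.
by rewrite -(fineK xf) -(fineK yf) -!EFinM -EFinD ltry.
Qed.

HB.instance Definition _ := GRing.isSubmodClosed.Build C (nat -> H) ell2_pred
  (GRing.submod_closed_semi ell2_submod).

Record ell2 := Ell2 { ell2_val :> nat -> H; ell2_in : ell2_val \in ell2_pred }.

HB.instance Definition _ := [isSub for ell2_val].
HB.instance Definition _ := [Choice of ell2 by <:].
HB.instance Definition _ := [SubChoice_isSubLmodule of ell2 by <:].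

Implicit Types x y z : ell2.

Lemma ell2P x : (nn_sum x < +oo)%E.
Proof. exact: ell2_in. Qed.

Lemma ell2_eq x y : x =1 y -> x = y.
Proof. by move=> h; apply/val_inj/funext. Qed.

Definition ell2_dot x y : C^o := limn (series (fun k => dot (x k) (y k) : C^o)).

Lemma cvg_ell2_dot x y :
  series (fun k => dot (x k) (y k) : C^o) @ \oo --> ell2_dot x y.
Proof.
apply: (cvg_complex_series_dominated (v := fun k => nrm (x k) ^+ 2 + nrm (y k) ^+ 2)).
  move=> n; rewrite (le_trans (dot_cabs_le _ _))//.
  have := sqr_ge0 (nrm (x n) - nrm (y n)).
  have := nrm_ge0 (x n); have := nrm_ge0 (y n); nra.
under eq_eseriesr do rewrite EFinD.
rewrite nneseriesD//; exact: lte_add_pinfty (ell2P x) (ell2P y).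
Qed.

Lemma ell2_dot_lim x y (l : C^o) :
  series (fun k => dot (x k) (y k) : C^o) @ \oo --> l -> ell2_dot x y = l.
Proof. exact: cvg_lim. Qed.

Lemma ell2_dot_diag x :
  ell2_dot x x = (fine (nn_sum x))%:C.
Proof.
apply: ell2_dot_lim.
have -> : (fun k => dot (x k) (x k) : C^o) = (fun k => (nrm (x k) ^+ 2)%:C : C^o).
  by apply/funext => k; rewrite -dot_norm nrmE rmorphXn.
by apply/cvg_series_real/cvg_series_nneseries => [n|]; [exact: sqr_ge0|exact: ell2P].
Qed.

Definition ell2ip : semiip ell2.
Proof.
apply: (@SemiIP _ _ ell2_dot) => [a x y z|a x y z|x].
- apply: ell2_dot_lim.
  have -> : series (fun k => dot ((a *: x + y : ell2) k) (z k) : C^o) =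
     (a *: series (fun k => dot (x k) (z k) : C^o) +
      series (fun k => dot (y k) (z k) : C^o)).
    apply/funext => n; rewrite /series /= !fctE scaler_sumr -big_split.
    by apply: eq_bigr => i _; rewrite /= linearPl.
  by apply: cvgD; [apply: cvgZl_tmp|]; exact: cvg_ell2_dot.
- apply: ell2_dot_lim.
  have -> : series (fun k => dot (x k) ((a *: y + z : ell2) k) : C^o) =
     (a^*%C *: series (fun k => dot (x k) (y k) : C^o) +
      series (fun k => dot (x k) (z k) : C^o)).
    apply/funext => n; rewrite /series /= !fctE scaler_sumr -big_split.
    by apply: eq_bigr => i _; rewrite /= linearPr.
  by apply: cvgD; [apply: cvgZl_tmp|]; exact: cvg_ell2_dot.
- by rewrite ell2_dot_diag ler0c fine_ge0// nn_sum_ge0.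
Defined.

Lemma sqn_ell2 x : (sqn ell2ip x)%:E = nn_sum x.
Proof.
rewrite /sqn /= ell2_dot_diag /= fineK// ge0_fin_numE ?ell2P//.
exact: nn_sum_ge0.
Qed.

Lemma ell2_partial_le x n : \sum_(i < n) nrm (x i) ^+ 2 <= sqn ell2ip x.
Proof.
rewrite -lee_fin sqn_ell2 -sumEFin -(big_mkord xpredT (fun i => (nrm (x i) ^+ 2)%:E)).
exact: nneseries_lim_ge.
Qed.

Lemma nn_sum_le (x : nat -> H) (M : R) :
  (forall n, \sum_(i < n) nrm (x i) ^+ 2 <= M) -> (nn_sum x <= M%:E)%E.
Proof.
move=> h; apply: lime_le; first exact: is_cvg_nneseries.
by apply: nearW => n; rewrite sumEFin lee_fin big_mkord.
Qed.

Lemma nrm_coord_le x n : nrm (x n) <= sn ell2ip x.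
Proof.
rewrite -(@ler_pXn2r _ 2)// ?nnegrE ?nrm_ge0 ?sn_ge0// sn_sqr.
apply: le_trans (ell2_partial_le x n.+1).
by rewrite big_ord_recr /= lerDr sumr_ge0// => *; exact: sqr_ge0.
Qed.

Lemma ell2_complete : ip_complete ell2ip.
Proof.
move=> u uP.
have g0 n : 0 < (2^-1 ^+ n : R) by rewrite exprn_gt0.
have g1 n : (2^-1 ^+ n : R) <= 1 by rewrite exprn_ile1//; lra.
have [l lP] : exists l : nat -> H, forall k n, nrm (u n k - l k) <= 2^-1 ^+ n.
  suff /choice : forall k, exists lk, forall n, nrm (u n k - lk) <= 2^-1 ^+ n.
    by move=> [l lP]; exists l.
  move=> k; have [|lk lkP] := @dotip_complete R H (fun n => u n k).
    move=> n m nm; rewrite sn_dotip.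
    exact: le_trans (nrm_coord_le (u n - u m) k) (uP _ _ nm).
  by exists lk => n; rewrite -sn_dotip.
have h n : (nn_sum (fun k => (u n k - l k)%R) <= ((2^-1 ^+ n) ^+ 2)%R%:E)%E.
  apply: nn_sum_le => N; rewrite -subr_le0.
  (* Fatou's argument on the first [N] coordinates: [l] is replaced by [u (n + m)] at a cost of
     [3 * 2^-1 ^+ m] each, since (q + g)^2 <= q^2 + 3 g for q and g in [0, 1]. *)
  apply: (@le_geom0 _ _ (3 * N%:R)) => m.
  have gnm : (2^-1 ^+ (n + m) : R) <= 2^-1 ^+ m by rewrite ler_wiXn2l// ?leq_addl//; lra.
  rewrite lerBlDl.
  have := ell2_partial_le (u n - u (n + m)%N) N.
  have a : sqn ell2ip (u n - u (n + m)%N) <= (2^-1 ^+ n) ^+ 2.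
    by rewrite -sn_sqr ler_pXn2r// ?nnegrE ?sn_ge0 ?(ltW (g0 _))// uP// leq_addr.
  move=> b; apply: le_trans (lerD (le_trans b a) (lexx _)).
  have -> : 3 * N%:R * 2^-1 ^+ m = \sum_(i < N) (3 * 2^-1 ^+ m : R).
    by rewrite sumr_const card_ord -[RHS]mulr_natr mulrAC.
  rewrite -big_split; apply: ler_sum => i _ /=.
  have p1 : nrm (u n i - u (n + m)%N i) <= 1.
    rewrite (le_trans (nrm_coord_le (u n - u (n + m)%N) i))//.
    by rewrite (le_trans (uP _ _ (leq_addr _ _))).
  have p2 : nrm (u n i - l i) <= nrm (u n i - u (n + m)%N i) + 2^-1 ^+ m.
    rewrite -(subrK (u (n + m)%N i) (u n i)) -addrA (le_trans (nrmD _ _))// subrK lerD2l.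
    exact: le_trans (lP _ _) gnm.
  move: (nrm_ge0 (u n i - l i)) (nrm_ge0 (u n i - u (n + m)%N i)) (g0 m) (g1 m).
  move: p1 p2; move: (nrm _) (nrm _) (2^-1 ^+ m) => p q r *; nra.
have lin : l \in ell2_pred.
  have -> : l = ell2_val (u 0%N) - (fun k => u 0%N k - l k).
    by apply/funext => k; rewrite !fctE opprB addrC subrK.
  by rewrite rpredB ?ell2_in// inE (le_lt_trans (h 0%N))// ltry.
exists (Ell2 lin) => n.
rewrite -(@ler_pXn2r _ 2)// ?nnegrE ?sn_ge0 ?(ltW (g0 _))// sn_sqr.
by rewrite -lee_fin sqn_ell2; exact: h.
Qed.

End SquareSummable.

(** * Amplification of operators to square summable sequences *)

Section Amplification.
Context {R : realType}.
Local Notation C := R[i].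
Variable H : hilbertType R.
Implicit Types (x y z : ell2 H) (S T : 'B(H)).

Lemma amp_subproof T x : (fun n => T (x n)) \in @ell2_pred R H.
Proof.
have h := nn_sum_bound (nrm_ge0 T) (fun n => nrm_bop T (x n)).
by rewrite inE (le_lt_trans h)// -sqn_ell2 -EFinM ltry.
Qed.

Definition amp T x : ell2 H := Ell2 (amp_subproof T x).

Lemma ampBr T x y : amp T (x - y) = amp T x - amp T y.
Proof. by apply: ell2_eq => n /=; rewrite bopB. Qed.

Lemma amp_comp S T x : amp (S \oc T) x = amp S (amp T x).
Proof. exact: ell2_eq. Qed.

Lemma amp_adjoint T x y : ell2ip H (amp T x) y = ell2ip H x (amp (adjoint T) y).
Proof.
rewrite /= /ell2_dot.
suff -> : (fun k => dot (amp T x k) (y k) : C^o) =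
  (fun k => dot (x k) (amp (adjoint T) y k)) by [].
by apply/funext => k /=; rewrite adjointE.
Qed.

Lemma sn_amp T x : sn (ell2ip H) (amp T x) <= nrm T * sn (ell2ip H) x.
Proof.
rewrite -(@ler_pXn2r _ 2)// ?nnegrE ?mulr_ge0 ?sn_ge0 ?nrm_ge0// exprMn !sn_sqr.
rewrite -lee_fin EFinM !sqn_ell2.
exact: nn_sum_bound (nrm_ge0 T) (fun n => nrm_bop T (x n)).
Qed.

(** A bijection of [nat] with [nat * nat] identifies l^2(l^2(H)) with l^2(H), compatibly with every
    [amp T]. Countably many vectors thus merge into one, which is the gain from working in l^2(H)
    rather than in H. *)
Lemma ell2_flatten (X : nat -> ell2 H) (M : R) :
  (forall n, \sum_(k < n) sqn (ell2ip H) (X k) <= M) ->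
  exists z, sqn (ell2ip H) z <= M /\ forall T,
    (sqn (ell2ip H) (amp T z))%:E = (\sum_(k <oo) (sqn (ell2ip H) (amp T (X k)))%:E)%E.
Proof.
move=> XM.
have /pcard_eqP[f] : ([set: nat] #= [set: nat * nat])%card.
  by rewrite card_eq_sym; exact: card_nat2.
pose z i := X (f i).1 (f i).2.
have reindex (g : H -> R) : (forall h, 0 <= g h) ->
    (\sum_(i <oo) (g (z i))%:E = \sum_(k <oo) \sum_(j <oo) (g (X k j))%:E)%E.
  move=> g0; rewrite nneseries_esumT; last by move=> *; rewrite lee_fin.
  rewrite -(@reindex_esum R _ _ setT setT f (fun p => (g (X p.1 p.2))%:E)); last exact: bij.
  have E k : (\sum_(j <oo) (g (X k j))%:E = \esum_(j in [set: nat]) (g (X k j))%:E)%E.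
    by rewrite nneseries_esumT// => *; rewrite lee_fin.
  rewrite (eq_eseriesr (fun k _ => E k)).
  rewrite nneseries_esumT; last by move=> n; apply: esum_ge0 => *; rewrite lee_fin.
  rewrite esum_esum; last by move=> *; rewrite lee_fin.
  suff -> : [set: nat] `*`` (fun=> [set: nat]) = [set: nat * nat] by [].
  by apply/seteqP; split.
have zM : (nn_sum z <= M%:E)%E.
  rewrite /nn_sum (reindex (fun h => nrm h ^+ 2)); last by move=> h; exact: sqr_ge0.
  apply: lime_le; first by apply: is_cvg_nneseries => *; exact: nn_sum_ge0.
  apply: nearW => n; apply: le_trans (_ : (\sum_(0 <= k < n) (sqn (ell2ip H) (X k))%:E <= _)%E).
    by apply: lee_sum => i _; rewrite sqn_ell2.
  by rewrite sumEFin lee_fin big_mkord.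
have zin : z \in @ell2_pred R H by rewrite inE (le_lt_trans zM)// ltry.
exists (Ell2 zin); split; first by rewrite -lee_fin sqn_ell2.
move=> T; rewrite sqn_ell2 /nn_sum (reindex (fun h => nrm (T h) ^+ 2)); last first.
  by move=> h; exact: sqr_ge0.
by apply: eq_eseriesr => k _; rewrite sqn_ell2.
Qed.

Lemma ell2_flatten_seq (s : seq (ell2 H)) : exists z,
  sqn (ell2ip H) z <= \sum_(x <- s) sqn (ell2ip H) x /\
  forall T, \sum_(x <- s) sqn (ell2ip H) (amp T x) <= sqn (ell2ip H) (amp T z).
Proof.
have [n|z [zM zT]] := @ell2_flatten (nth 0 s) (\sum_(x <- s) sqn (ell2ip H) x).
  elim: s n => [|x s ih] n.
    rewrite big_nil big1 => [//|i _]; rewrite nth_nil.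
    by rewrite /sqn sip0l.
  case: n => [|n]; first by rewrite big_ord0 sumr_ge0// => *; exact: sqn_ge0.
  by rewrite big_ord_recl big_cons /= lerD2l; exact: ih.
exists z; split=> // T.
rewrite (big_nth 0) -lee_fin zT -sumEFin; apply: nneseries_lim_ge => *.
by rewrite lee_fin sqn_ge0.
Qed.

End Amplification.

(** * Ultraweakly continuous functionals *)

Section Ultraweak.
Context {R : realType}.
Local Notation C := R[i].
Variable H : hilbertType R.
Local Notation ip := (ell2ip H).

Lemma square_summable_ell2 (x : nat -> H) : square_summable x -> x \in @ell2_pred R H.
Proof.
move=> /cvg_ex[l xl]; rewrite inE.
suff h : series (fun k => nrm (x k) ^+ 2) @ \oo --> complex.Re (l : C).
  rewrite /nn_sum (nneseries_cvg_real _ h) ?ltry// => n; exact: sqr_ge0.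
apply/cvgrPdist_lt => e e0; have e1 : 0 < e%:C by rewrite ltcR.
have /cvgrPdist_lt/(_ _ e1) := xl; apply: filterS => n.
rewrite cabsE ltcR; apply: le_lt_trans.
have -> : series (fun k => nrm (x k) ^+ 2) n =
    complex.Re (series (fun k => `|x k| ^+ 2 : C^o) n).
  rewrite Re_series; congr (series _ n); apply/funext => k.
  by rewrite nrmE -rmorphXn.
by rewrite -ReB norm_Re_le.
Qed.

Lemma ell2_square_summable (x : ell2 H) : square_summable x.
Proof.
rewrite /square_summable.
suff -> : (fun k => `|x k| ^+ 2 : C^o) = (fun k => (nrm (x k) ^+ 2)%:C : C^o).
  apply: cvgP; apply: cvg_series_real; apply: cvg_series_nneseries => [n|].
    exact: sqr_ge0.
  exact: ell2P.
by apply/funext => k; rewrite nrmE rmorphXn.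
Qed.

Definition pair_of_ell2 (x y : ell2 H) : l2pair H :=
  L2pair (@ell2_square_summable x) (@ell2_square_summable y).

(* The neighbourhood filter of 0 for the ultraweak topology, in a form that
   hands over finitely many vectors. *)
Definition uw_filter : set_system (uwot H) := [set U |
  exists ps : seq (ell2 H * ell2 H), forall T : 'B(H),
    (forall p, p \in ps -> cabs (ip (amp T p.1) p.2) < 1) -> U T].

Lemma uw_filter_filter : Filter uw_filter.
Proof.
split.
- by exists [::].
- move=> P Q [ps psP] [qs qsQ]; exists (ps ++ qs) => T h; split.
    by apply: psP => p pp; apply: h; rewrite mem_cat pp.
  by apply: qsQ => p pp; apply: h; rewrite mem_cat pp orbT.
- by move=> P Q PQ [ps psP]; exists ps => T /psP; exact: PQ.
Qed.

Lemma uw_filter_cvg : uw_filter --> (0 : uwot H).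
Proof.
have FF := uw_filter_filter.
have pw (p : l2pair H) : (fun T : uwot H => uw_functional T p) @ uw_filter -->
    (0 : C^o).
  apply/cvgrPdist_lt => e e0; have [e1 ee] := ge0_Re (ltW e0).
  have {e1}e1 : 0 < complex.Re e by rewrite -ltcR -ee.
  pose x := Ell2 (square_summable_ell2 (@l2fst_summable _ _ p)).
  pose y := Ell2 (square_summable_ell2 (@l2snd_summable _ _ p)).
  (* The radius is absorbed into the first vector, so neighbourhoods of radius 1 suffice. *)
  exists [:: ((complex.Re e)^-1%:C *: x, y)] => T /(_ _ (mem_head _ _)) /=.
  have -> : amp T ((complex.Re e)^-1%:C *: x) = (complex.Re e)^-1%:C *: amp T x.
    by apply: ell2_eq => n /=; rewrite bopZ.
  rewrite -[ell2_dot _ _]/(ip _ y) sipZl cabsM cabs_real ger0_norm ?invr_ge0 ?(ltW e1)//.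
  rewrite mulrC ltr_pdivrMr// mul1r => h.
  by rewrite /= sub0r normrN ee cabsE ltcR.
have z0 (p : l2pair H) : uw_functional 0 p = 0.
  suff -> : uw_functional 0 p = limn (cst 0 : nat -> C^o) by exact: lim_cst.
  congr (limn _); apply/funext => n; rewrite /series /= big1// => i _.
  by rewrite linear0l.
have hcvg : (fun T : uwot H => uw_functional T : {ptws l2pair H -> C^o}) @ uw_filter -->
    (uw_functional (0 : 'B(H)) : {ptws l2pair H -> C^o}).
  apply/cvg_sup => p; move=> U [_ [[D oD <-] /= D0] DU].
  have : nbhs (0 : C^o) D by apply: open_nbhs_nbhs; split=> //; rewrite -(z0 p).
  move=> /(pw p) pD; apply: (@filterS _ uw_filter FF _ _ _ pD) => T DT.
  exact: DU.
move=> U [_ [[P oP <-] /= P0] PU].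
have : nbhs (uw_functional (0 : 'B(H)) : {ptws l2pair H -> C^o}) P.
  exact: open_nbhs_nbhs.
move=> /hcvg hP; apply: (@filterS _ uw_filter FF _ _ _ hP) => T PT.
exact: PU.
Qed.

Variable A : cstar_subalgebra H.

(** Continuity at 0 hands over finitely many pairs, and homogeneity turns the neighbourhood into a
    bound of |tau(T)| by the sum of |<T p1, p2>|. At T^* T each term becomes <T p1, T p2>, so it is
    enough that [z] collects all the p1 and p2. *)
Lemma normal_dominated (tau : 'B(H) -> C) :
  (forall a S T, S \in A -> T \in A -> tau (a *: S + T) = a * tau S + tau T) ->
  {within (uw_closure A : set (uwot H)), continuous (tau : uwot H -> C^o)} ->
  exists z : ell2 H,
    (forall T, T \in A -> cabs (tau (adjoint T \oc T)) <= sqn ip (amp T z)) /\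
    exists M, forall T, T \in A -> cabs (tau T) <= M * sn ip (amp T z).
Proof.
move=> tl tc.
have A0 : (0 : 'B(H)) \in A by case: (cstar_submod A).
have N0 : uw_closure A 0 by apply: subset_closure.
have t0 : tau 0 = 0.
  by have := tl (-1) 0 0 A0 A0; rewrite scaler0 addr0 mulN1r addNr.
have AZ a T : T \in A -> a *: T \in A.
  by move=> TA; have [_ /(_ a T 0 TA A0)] := cstar_submod A; rewrite addr0.
have tZ a T : T \in A -> tau (a *: T) = a * tau T.
  by move=> TA; rewrite -[a *: T]addr0 tl// t0 addr0.
have := (subspace_continuousP _ _).1 tc _ N0.
move=> /cvgrPdist_lt/(_ 1 ltr01)/uw_filter_cvg[ps psP].
have {}psP T : T \in A ->
    (forall p, p \in ps -> cabs (ip (amp T p.1) p.2) < 1) -> cabs (tau T) < 1.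
  move=> TA /psP; have NT : uw_closure A T by exact: subset_closure.
  move=> /(_ NT) h; rewrite -ltcR -cabsE -[tau T]opprK normrN.
  by rewrite -[- tau T]add0r -{1}t0.
have {}psP T : T \in A -> cabs (tau T) <= \sum_(p <- ps) cabs (ip (amp T p.1) p.2).
  move=> TA; set s := \sum_(p <- ps) _.
  have s0 : 0 <= s by apply: sumr_ge0 => *; exact: cabs_ge0.
  (* The slack [e] keeps the scaling by [(s + e)^-1] meaningful when [s = 0]. *)
  apply/ler_addgt0Pr => e e0; have r0 : 0 < s + e by rewrite ltr_wpDl.
  have sc (c : C) : (cabs ((s + e)^-1%:C * c) < 1) = (cabs c < s + e).
    rewrite cabsM cabs_real ger0_norm ?invr_ge0 ?(ltW r0)//.
    by rewrite mulrC ltr_pdivrMr// mul1r.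
  have := psP _ (AZ (s + e)^-1%:C _ TA); rewrite tZ// sc => h; apply/ltW/h => p pps.
  have -> : amp ((s + e)^-1%:C *: T) p.1 = (s + e)^-1%:C *: amp T p.1 by exact: ell2_eq.
  rewrite sipZl sc (@le_lt_trans _ _ s)// ?ltrDl//.
  rewrite /s (big_rem p)//= lerDl sumr_ge0// => *; exact: cabs_ge0.
have [z [_ zT]] := ell2_flatten_seq (map fst ps ++ map snd ps).
have {}zT T : \sum_(p <- ps) (sqn ip (amp T p.1) + sqn ip (amp T p.2)) <= sqn ip (amp T z).
  by move: (zT T); rewrite big_cat !big_map big_split.
exists z; split=> [T TA|].
  apply: le_trans (zT T); apply: le_trans (psP _ _) _.
    by apply: cstar_comp => //; exact: cstar_adjoint.
  apply: ler_sum => p _.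
  have -> : ip (amp (adjoint T \oc T) p.1) p.2 = ip (amp T p.1) (amp T p.2).
    by rewrite amp_comp amp_adjoint adjointK.
  rewrite (le_trans (sip_le _ _ _))// -!sn_sqr.
  have := sqr_ge0 (sn ip (amp T p.1) - sn ip (amp T p.2)).
  have := sn_ge0 ip (amp T p.1); have := sn_ge0 ip (amp T p.2); nra.
exists (\sum_(p <- ps) sn ip p.2) => T TA; rewrite (le_trans (psP _ TA))// mulr_suml.
rewrite big_seq [leRHS]big_seq; apply: ler_sum => p pps.
rewrite (le_trans (sip_le _ _ _))// mulrC ler_wpM2l ?sn_ge0//.
rewrite -(@ler_pXn2r _ 2)// ?nnegrE ?sn_ge0// !sn_sqr (le_trans _ (zT T))//.
rewrite (big_rem p)//= -addrA lerDl addr_ge0 ?sqn_ge0// sumr_ge0// => *.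
by rewrite addr_ge0 ?sqn_ge0.
Qed.

End Ultraweak.

(** * Positive functionals as sums of vector functionals *)

Section DominatedFunctionals.
Context {R : realType} {H : hilbertType R}.
Local Notation C := R[i].
Variable A : cstar_subalgebra H.
Local Notation E := (cstar_elt A).
Local Notation ip := (ell2ip H).
Implicit Types a b c : E.

Definition elt_adj a : E := CstarElt (cstar_adjoint (elt_in a)).

Local Infix "**" := elt_mul (at level 40, left associativity).

Lemma elt_eq a b : elt_val a =1 elt_val b -> a = b.
Proof. by move=> h; apply/val_inj/bop_eq. Qed.

Lemma elt_mulA a b c : a ** (b ** c) = a ** b ** c.
Proof. exact: elt_eq. Qed.

Lemma elt_mul_linearl (s : C) a b c : (s *: a + b) ** c = s *: (a ** c) + b ** c.
Proof. exact: elt_eq. Qed.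

Lemma elt_mul_linearr (s : C) a b c : c ** (s *: a + b) = s *: (c ** a) + c ** b.
Proof. by apply: elt_eq => x /=; rewrite bop_linear. Qed.

Lemma elt_adjP (s : C) a b : elt_adj (s *: a + b) = s^*%C *: elt_adj a + elt_adj b.
Proof. by apply: val_inj; exact: adjointP. Qed.

Lemma elt_adjM a b : elt_adj (a ** b) = elt_adj b ** elt_adj a.
Proof. by apply: val_inj; exact: adjointM. Qed.

Lemma elt_adjK a : elt_adj (elt_adj a) = a.
Proof. by apply: val_inj; exact: adjointK. Qed.

Lemma amp_mul a b x : amp (a ** b) x = amp a (amp b x).
Proof. exact: amp_comp. Qed.

Lemma amp_adj a x y : ip (amp (elt_adj a) x) y = ip x (amp a y).
Proof. by rewrite amp_adjoint /= adjointK. Qed.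

Section FixedVector.
Variable z : ell2 H.

(** The last clause takes the place of |phi(a)|^2 <= phi(1) phi(a^* a), as A need not have a unit.
    It is the bound to which Riesz' theorem is applied. *)
Definition dominated_positive (phi : E -> C) :=
  [/\ forall s a b, phi (s *: a + b) = s * phi a + phi b,
      forall a, 0 <= phi (elt_adj a ** a),
      forall a, complex.Re (phi (elt_adj a ** a)) <= sqn ip (amp a z) &
      exists M, forall a, cabs (phi a) <= M * sn ip (amp a z)].

(** The Gelfand-Naimark-Segal form, left on A without quotient or completion. *)
Definition gns (phi : E -> C) (pd : dominated_positive phi) : semiip E.
Proof.
case: pd => l p _ _.
apply: (@SemiIP _ _ (fun a b => phi (elt_adj b ** a))) => [s a b c|s a b c|//].
- by rewrite elt_mul_linearr l.
- by rewrite elt_adjP elt_mul_linearl l.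
Defined.

Lemma gnsE phi (pd : dominated_positive phi) a b :
  gns pd a b = phi (elt_adj b ** a).
Proof. by case: pd. Qed.

Lemma sn_gns_le phi (pd : dominated_positive phi) a : sn (gns pd) a <= sn ip (amp a z).
Proof. by rewrite ler_wsqrtr// /sqn gnsE; case: pd. Qed.

(* [v] is the Riesz vector of [phi] in the closure of the orbit of [z]. *)
Lemma dominated_positive_peel phi : dominated_positive phi -> exists v : ell2 H,
  (forall a, cabs (phi (elt_adj a ** a)) <= sn ip (amp a v) * sn ip (amp a z)) /\
  dominated_positive (fun a => phi a - ip (amp a v) v).
Proof.
move=> pd; have [l p d [M phiM]] := pd.
have [v [phiv vapp]] : exists v, (forall a, phi a = ip (amp a z) v) /\
    forall e, 0 < e -> exists a, sn ip (amp (elt_val a) z - v) <= e.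
  have jl : linear (fun a : E => amp a z) by move=> s a b; exact: ell2_eq.
  exact: (riesz jl (@ell2_complete R H) l phiM).
have form a b : phi (elt_adj b ** a) = ip (amp a v) (amp b z).
  have := sip_herm (gns pd) b a; rewrite !gnsE => ->.
  by rewrite phiv amp_mul amp_adj -sip_herm.
(* This bound keeps the remainder positive. Replacing one [v] by a nearby [c z] turns |a v|^2 into
   phi((a c)^* a), which is at most q |a c z|, close to q |a v|. The denominator [(q + x) * K + 1]
   makes the total error at most [e]. *)
have vle a : sn ip (amp a v) <= sn (gns pd) a.
  set x := sn ip _; set q := sn _ a; pose K := nrm (elt_val a).
  have x0 : 0 <= x by exact: sn_ge0.
  have q0 : 0 <= q by exact: sn_ge0.
  have K0 : 0 <= K by exact: nrm_ge0.
  suff h : x ^+ 2 <= q * x.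
    by move: x0; rewrite le_eqVlt => /predU1P[<-//|x1]; rewrite -(ler_pM2r x1) -expr2.
  apply/ler_addgt0Pr => e e0.
  have k0 : 0 < (q + x) * K + 1 by rewrite ltr_wpDl// mulr_ge0// addr_ge0.
  have [c cv] := vapp _ (divr_gt0 e0 k0).
  have cv' : sn ip (amp a (amp c z - v)) <= K * (e / ((q + x) * K + 1)).
    by rewrite (le_trans (sn_amp _ _))// ler_wpM2l.
  have h1 : complex.Re (ip (amp a v) (amp a (amp c z))) <=
      q * (x + K * (e / ((q + x) * K + 1))).
    rewrite -amp_mul -form -gnsE (le_trans (Re_sip_le _ _ _))// ler_wpM2l//.
    rewrite (le_trans (sn_gns_le _ _))// amp_mul.
    have -> : amp a (amp c z) = amp a v + amp a (amp c z - v).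
      by rewrite ampBr addrC subrK.
    by rewrite (le_trans (snD _ _ _))// lerD2l.
  have h2 := Re_sip_le ip (amp a v) (- amp a (amp c z - v)).
  rewrite snN -/x in h2.
  have h3 : x ^+ 2 = complex.Re (ip (amp a v) (amp a (amp c z))) +
      complex.Re (ip (amp a v) (- amp a (amp c z - v))).
    by rewrite sn_sqr /sqn -ReD -sipDr ampBr opprB addrC subrK.
  have h4 : (q + x) * (K * (e / ((q + x) * K + 1))) <= e.
    rewrite mulrA mulrCA ler_piMr ?(ltW e0)// ler_pdivrMr// mul1r; lra.
  have := ler_wpM2l x0 cv'; nra.
have vle2 a : sqn ip (amp a v) <= complex.Re (phi (elt_adj a ** a)).
  have -> : complex.Re (phi (elt_adj a ** a)) = sn (gns pd) a ^+ 2 by rewrite sn_sqr /sqn gnsE.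
  by rewrite -sn_sqr ler_pXn2r// nnegrE sn_ge0.
exists v; split=> [a|]; first by rewrite form sip_le.
have diag a : ip (amp (elt_adj a ** a) v) v = (sqn ip (amp a v))%:C.
  by rewrite amp_mul amp_adj sqnE.
split.
- move=> s a b; rewrite l (_ : amp _ v = s *: amp a v + amp b v); last exact: ell2_eq.
  by rewrite sip_linearl; ring.
- move=> a; rewrite diag; have [_ ->] := ge0_Re (p a).
  by rewrite -rmorphB ler0c subr_ge0.
- move=> a; rewrite diag ReB /=; have := d a; have := sqn_ge0 ip (amp a v); lra.
exists (M + sn ip v) => a; rewrite (le_trans (cabsD _ _))// cabsN mulrDl lerD//.
rewrite (le_trans (sip_le _ _ _))// mulrC ler_wpM2l ?sn_ge0//.
exact: le_trans (vle a) (sn_gns_le pd a).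
Qed.

(* Peeling repeatedly, [phi] minus the first [n] vector functionals is a
   residue [r n] with [r n ^+ 2 <= c * (r n - r n.+1)], hence tends to 0. *)
Lemma dominated_positive_vectors phi : dominated_positive phi ->
  exists v : nat -> ell2 H, forall a,
    series (fun k => sqn ip (amp a (v k))) @ \oo --> complex.Re (phi (elt_adj a ** a)).
Proof.
move=> pd0.
pose step (f : {phi | dominated_positive phi}) := cid (dominated_positive_peel (projT2 f)).
pose next f : {phi | dominated_positive phi} :=
  exist _ _ (projT2 (step f)).2.
pose f n := iter n next (exist _ phi pd0).
pose v n := projT1 (step (f n)).
exists v => a; pose r n := complex.Re (projT1 (f n) (elt_adj a ** a)).
have r0 n : 0 <= r n by have [_ /(_ a)/ge0_Re[]] := projT2 (f n).
have rS n : r n.+1 = r n - sqn ip (amp a (v n)).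
  have fS : projT1 (f n.+1) = fun a => projT1 (f n) a - ip (amp a (v n)) (v n) by [].
  by rewrite /r fS ReB amp_mul amp_adj.
have sE n : series (fun k => sqn ip (amp a (v k))) n = r 0%N - r n.
  rewrite /series /=; elim: n => [|n ih]; first by rewrite big_geq// subrr.
  by rewrite big_nat_recr//= ih rS; lra.
have q0 n : 0 <= sqn ip (amp a (v n)) by exact: sqn_ge0.
have cv : cvgn (series (fun k => sqn ip (amp a (v k)))).
  apply: nondecreasing_is_cvgn; first by apply/nondecreasing_series => n _ _.
  by exists (r 0%N) => _ [n _ <-]; rewrite sE lerBlDr lerDl.
have rq n : r n ^+ 2 <= sqn ip (amp a (v n)) * sqn ip (amp a z).
  have [/(_ a) h _] := projT2 (step (f n)).
  rewrite -!sn_sqr -exprMn ler_pXn2r ?nnegrE ?mulr_ge0 ?sn_ge0//.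
  exact: le_trans (Re_le_cabs _) h.
have rc : r @ \oo --> 0.
  apply/cvgrPdist_lt => e e0.
  have k0 : 0 < sqn ip (amp a z) + 1 by rewrite ltr_wpDl// sqn_ge0.
  have d0 : 0 < e ^+ 2 / (sqn ip (amp a z) + 1) by rewrite divr_gt0// exprn_gt0.
  have /cvgrPdist_lt/(_ _ d0) := cvg_series_cvg_0 cv; apply: filterS => n.
  rewrite !sub0r !normrN !ger0_norm// ltr_pdivlMr// => h.
  rewrite -(@ltr_pXn2r _ 2)// ?nnegrE ?(ltW e0)//.
  apply: le_lt_trans (rq n) _; apply: le_lt_trans h; rewrite mulrDr mulr1 lerDl//.
rewrite (_ : series _ = (fun n => r 0%N - r n)); last by apply/funext => n; exact: sE.
by rewrite -[X in _ --> X]subr0; apply: cvgB => //; exact: cvg_cst.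
Qed.

End FixedVector.
End DominatedFunctionals.

(** * Approximate polar decomposition *)

Section PolarIteration.
Context {R : realType} {H : hilbertType R}.
Local Notation C := R[i].
Variable A : cstar_subalgebra H.
Local Notation E := (cstar_elt A).
Implicit Types (a b c d w : E) (u : H) (K S T : 'B(H)).
Local Infix "**" := elt_mul (at level 40, left associativity).

Lemma idop_subproof : (fun u : H => u) \in bounded_linear.
Proof. by apply/bounded_linearP; split=> //; exists 1 => x; rewrite mul1r. Qed.

Definition idop : 'B(H) := Bop idop_subproof.

Definition defect w : 'B(H) := idop - (w \oc adjoint w).

(** Left multiplication by [defect w], written so that the result lies in A even when the identity
    of H does not. *)
Definition elt_defect w d : E := d - w ** (elt_adj w ** d).

Lemma defectE w u : defect w u = u - elt_val w (adjoint w u).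
Proof. by []. Qed.

Lemma defect_adj w x y : dot (defect w x) y = dot x (defect w y).
Proof.
by rewrite !defectE linearBl linearBr /= adjointE (adjointEr w).
Qed.

Lemma elt_sumE (I : Type) (r : seq I) (F : I -> E) u :
  elt_val (\sum_(i <- r) F i) u = \sum_(i <- r) F i u.
Proof.
elim: r => [|i r ih]; first by rewrite !big_nil.
by rewrite !big_cons -ih.
Qed.

Definition half : C := (2^-1 : R)%:C.
Definition sqrt_half : C := (Num.sqrt 2^-1 : R)%:C.

Lemma sqrt_half_sqr : sqrt_half^*%C * sqrt_half = half.
Proof. by rewrite conjc_real -rmorphM /= -expr2 sqr_sqrtr// invr_ge0. Qed.

(* One step [w -> (1 + F^2 / 2) w], [F = 1 - w w^*], of an iteration converging
   to the partial isometry of the polar decomposition of [b]. The factor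
   [1 + F^2 / 2] is a sum of squares, so that [b^* w] remains an explicit sum
   of terms [d^* d], with [d] in the list carried along. *)
Definition polar_next (wD : E * seq E) : E * seq E :=
  let F := elt_defect wD.1 in
  (half *: F (F wD.1) + wD.1, wD.2 ++ [seq sqrt_half *: F d | d <- wD.2]).

Variable b : E.
Hypothesis b1 : nrm (elt_val b) <= 1.

Definition commuting K := forall u, K (b (adjoint b u)) = b (adjoint b (K u)).

(** The first clause ranges over [K] because one step replaces K by K + F K F / 2, so K = 1 alone
    would not be inductive; K = F^2 later gives the gain of a step. The second clause makes F
    commute with K. The head of the list stays [b], so that this gain contains the term of [b]. *)
Definition polar_inv (wD : E * seq E) :=
  [/\ forall K, commuting K -> forall u,
        \sum_(d <- wD.2) adjoint d (K (d u)) = adjoint b (K (wD.1 u)),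
      forall K, commuting K -> forall u,
        K (wD.1 (adjoint wD.1 u)) = wD.1 (adjoint wD.1 (K u)),
      forall u, nrm (adjoint wD.1 u) <= nrm u &
      head 0 wD.2 = b /\ wD.2 != [::] ].

Lemma polar_inv0 : polar_inv (b, [:: b]).
Proof. by split=> //= [K _ u|u]; [rewrite big_seq1|exact: adjoint_le1]. Qed.

Lemma nrm_contraction w : (forall u, nrm (adjoint w u) <= nrm u) -> nrm (elt_val w) <= 1.
Proof.
move=> wc; have w1 : nrm (adjoint w) <= 1.
  by apply: nrm_bop_le => // u; rewrite mul1r.
by apply: nrm_bop_le => // u; rewrite mul1r -[elt_val w]adjointK; exact: adjoint_le1.
Qed.

(** Expanding |u - w w^* u|^2 and using |w w^* u| <= |w^* u| gives F^2 <= F for F = [defect w], the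
    only order relation that the iteration needs. *)
Lemma defect_ge w u : (forall u, nrm (adjoint w u) <= nrm u) ->
  nrm (defect w u) ^+ 2 <= complex.Re (dot (defect w u) u).
Proof.
move=> wc; have w1 := nrm_contraction wc.
pose x := adjoint w u; pose y := elt_val w x.
have yu : complex.Re (dot y u) = nrm x ^+ 2.
  by rewrite -sqn_dotip /sqn /= /y adjointE.
have wx : nrm y <= nrm x by rewrite (le_trans (nrm_bop _ _))// ler_piMl ?nrm_ge0.
rewrite defectE -/x -/y linearBl /= ReB yu -!sqn_dotip.
rewrite sqnB (ReC (dotip H) y u) /= yu !sqn_dotip.
have := wx; rewrite -(@ler_pXn2r _ 2)// ?nnegrE ?nrm_ge0// => {}wx.
rewrite -sqn_dotip /sqn /=; lra.
Qed.

(** Since b b^* commutes with itself, the second clause of the invariant applies to K = b b^*. *)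
Lemma defect_commuting wD : polar_inv wD ->
  commuting (defect wD.1) /\
  forall K, commuting K -> forall u, K (defect wD.1 u) = defect wD.1 (K u).
Proof.
move=> [_ wc _ _].
have Kd K : commuting K -> forall u, K (defect wD.1 u) = defect wD.1 (K u).
  by move=> Kc u; rewrite !defectE bopB wc.
split=> // u; have cc : commuting (b \oc adjoint b) by [].
by have := Kd _ cc u => /= <-.
Qed.

Lemma adjoint_next wD u : adjoint (polar_next wD).1 u =
  adjoint wD.1 (u + half *: defect wD.1 (defect wD.1 u)).
Proof.
set w := wD.1; pose F := defect w.
suff -> : adjoint (polar_next wD).1 = adjoint w \oc (idop + half *: (F \oc F)) by [].
apply: adjoint_uniq => x y.
rewrite -[bop_fun _ x]/(half *: F (F (w x)) + w x).
rewrite -[bop_fun _ y]/(adjoint w (y + half *: F (F y))) -adjointE.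
rewrite linearPl linearDr linearZr_LR /= addrC !defect_adj; congr (_ + _ * _).
exact/esym/conjc_real.
Qed.

Lemma polar_inv_next wD : polar_inv wD -> polar_inv (polar_next wD).
Proof.
move=> inv; have [Fc Fk] := defect_commuting inv.
have [wsum wcomm wcontr [wb wn]] := inv.
set w := wD.1 in Fc Fk wsum wcomm wcontr *; set D := wD.2 in wsum wb wn *.
pose F := defect w; have Fadj x y : dot (F x) y = dot x (F y) by exact: defect_adj.
have {}Fc u : F (b (adjoint b u)) = b (adjoint b (F u)) by exact: Fc.
have {}Fk K : commuting K -> forall u, K (F u) = F (K u) by exact: Fk.
have nE u : elt_val (polar_next wD).1 u = half *: F (F (w u)) + w u by [].
split.
- move=> K Kc u; rewrite nE big_cat big_map /= -big_split.
  pose K' : 'B(H) := half *: (F \oc K \oc F) + K.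
  have K'E x : K' x = half *: F (K (F x)) + K x by [].
  have K'c : commuting K'.
    by move=> x; rewrite !K'E Fc Kc Fc !bop_linear Kc.
  have hd d : adjoint (sqrt_half *: elt_defect w d : E) =
      sqrt_half^*%C *: (adjoint d \oc F).
    apply: adjoint_uniq => x y.
    rewrite -[bop_fun _ x]/(sqrt_half *: F (d x)).
    rewrite -[bop_fun _ y]/(sqrt_half^*%C *: adjoint d (F y)).
    rewrite linearZl_LR linearZr_LR /= Fadj adjointE; congr (_ * _).
    exact: esym (conjcK _).
  rewrite bop_linear (Fk _ Kc) -K'E -(wsum _ K'c).
  apply: eq_bigr => d _; rewrite hd K'E bop_linear addrC; congr (_ + _).
  rewrite -[LHS]/(sqrt_half^*%C *: adjoint d (F (K (sqrt_half *: F (d u))))).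
  by rewrite !bopZ scalerA sqrt_half_sqr.
- move=> K Kc u.
  rewrite !nE !adjoint_next -/w -/F bop_linear !(Fk _ Kc) (wcomm _ Kc) (bopD K) (bopZ K) !(Fk _ Kc).
  by [].
(* In terms of functional calculus, (1 + F^2/2)^2 (1 - F) <= 1 for 0 <= F <= 1. The expansion in u,
   F u and F^2 u uses F^2 <= F at u and at F u, and positivity of F at F^2 u. *)
- move=> u; rewrite adjoint_next -/w -/F.
  set y1 := F u; set y2 := F y1; set y := u + _.
  pose p := dotip H; pose h : R := 2^-1.
  have ge v : sqn p (F v) <= complex.Re (p (F v) v).
    by rewrite sqn_dotip; exact: defect_ge.
  have Fp v x : p (F v) x = p v (F x) by exact: Fadj.
  have wy : sqn p (adjoint w y) = sqn p y - complex.Re (p (F y) y).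
    have e : p (w (adjoint w y)) y = p (adjoint w y) (adjoint w y) by exact: adjointE.
    by rewrite /F defectE sipBl ReB e opprB addrC subrK.
  have Fy : F y = y1 + half *: F y2 by rewrite /y bopD bopZ.
  have half_conj (v x : H) : p v (half *: x) = h%:C * p v x.
    by rewrite sipZr [half^*%C](conjc_real h).
  have ge_u := ge u; have ge_y1 := ge y1.
  have ge_y2 := le_trans (sqn_ge0 p _) (ge y2).
  have ey1 : F u = y1 by []. have ey2 : F y1 = y2 by [].
  have ey : y = u + half *: y2 by [].
  clearbody F y y2 y1; rewrite ey1 in ge_u; rewrite ey2 in ge_y1.
  have uy2 : p u y2 = p y1 y1 by rewrite -ey2 -Fp ey1.
  have q1 : sqn p y = sqn p u + sqn p y1 + h ^+ 2 * sqn p y2.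
    rewrite ey sqnD half_conj uy2 ReZ sqnZ cabs_real -/(sqn p y1) real_normK ?num_real//.
    by rewrite mulrA divff// mul1r.
  have q2 : complex.Re (p (F y) y) = complex.Re (p y1 u) +
      2 * h * complex.Re (p y2 y1) + h ^+ 2 * complex.Re (p (F y2) y2).
    rewrite Fy ey !(sipDl, sipDr, half_conj, sipZl) !ReD !ReZ (Fp y2 u) ey1.
    rewrite (ReC p y2 y1) /h; lra.
  rewrite -(@ler_pXn2r _ 2)// ?nnegrE ?nrm_ge0// -!sqn_dotip -/p wy q1 q2.
  have := sqn_ge0 p y2; rewrite /h; lra.
- by rewrite /=; move: wb wn; rewrite /D; case: (wD.2) => //= d r ->.
Qed.

End PolarIteration.

(** * The form of a trace, and near-polar factors for it *)

Section TracialFunctional.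
Context {R : realType} {H : hilbertType R}.
Local Notation C := R[i].
Variable A : cstar_subalgebra H.
Local Notation E := (cstar_elt A).
Local Notation ip := (ell2ip H).
Implicit Types (a b c d w : E).
Local Infix "**" := elt_mul (at level 40, left associativity).
Variables (z : ell2 H) (t : E -> C).
Hypothesis pd : dominated_positive z t.
Hypothesis trace : forall a b, t (a ** b) = t (b ** a).
Local Notation s := (gns pd).

Lemma trace_sum (I : Type) (r : seq I) (F : I -> E) :
  t (\sum_(i <- r) F i) = \sum_(i <- r) t (F i).
Proof.
have [l _ _ _] := pd.
have t0 : t 0 = 0 by have := l (-1) 0 0; rewrite scaler0 addr0 mulN1r addNr.
elim: r => [|i r ih]; first by rewrite !big_nil.
by rewrite !big_cons -ih -{1}[F i]scale1r l mul1r.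
Qed.

Lemma sn_adj a : sn s (elt_adj a) = sn s a.
Proof. by rewrite /sn /sqn !gnsE elt_adjK trace. Qed.

Lemma sn_gns_norm a : sn s a <= nrm (elt_val a) * sn ip z.
Proof. exact: le_trans (sn_gns_le pd a) (sn_amp _ _). Qed.

(* The left module [E], with the seminorm of [s], embeds isometrically into a
   multiple of the representation [amp]. *)
Lemma gns_vector d : exists xi : ell2 H, sqn ip xi <= sqn s d /\
  forall a, sqn ip (amp a xi) = sqn s (a ** d).
Proof.
have [v vP] := dominated_positive_vectors pd.
have [n|xi [xiM xiT]] := @ell2_flatten R H (fun k => amp d (v k)) (sqn s d).
  rewrite /sqn gnsE -(cvg_lim _ (vP d))//.
  have nd : nondecreasing_seq (series (fun k => sqn ip (amp d (v k)))).
    by apply/nondecreasing_series => m _ _; exact: sqn_ge0.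
  have := nondecreasing_cvgn_le nd (cvgP _ (vP d)) n.
  by rewrite /series /= big_mkord.
exists xi; split=> // a; apply/EFin_inj; rewrite xiT.
have -> : sqn s (a ** d) = complex.Re (t (elt_adj (a ** d) ** (a ** d))).
  by rewrite /sqn gnsE.
rewrite -(nneseries_cvg_real _ (vP (a ** d))) => [//|n]; exact: sqn_ge0.
Qed.

(** Read off from the isometric embedding, where left multiplication becomes [amp a]; this avoids a
    square root of |a|^2 - a^* a. *)
Lemma sn_mul_le a d : sn s (a ** d) <= nrm (elt_val a) * sn s d.
Proof.
have [xi [xid xia]] := gns_vector d.
rewrite /sn -xia -/(sn ip _) (le_trans (sn_amp _ _))// ler_wpM2l ?nrm_ge0//.
by rewrite ler_wsqrtr.
Qed.

Lemma polar_approx b (e : R) : nrm (elt_val b) <= 1 -> 0 < e ->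
  exists w (D : seq E), [/\ nrm (elt_val w) <= 1,
    elt_adj b ** w = \sum_(d <- D) elt_adj d ** d &
    sqn s (elt_defect w b) <= e].
Proof.
move=> b1 e0; have [tl tp _ _] := pd.
pose st m := iter m (@polar_next R H A) (b, [:: b]).
have inv m : polar_inv b (st m).
  by elim: m => [|m ih]; [exact: polar_inv0|exact: polar_inv_next].
have wc m : nrm (elt_val (st m).1) <= 1.
  by have [_ _ h _] := inv m; exact: nrm_contraction.
have sumE m : elt_adj b ** (st m).1 = \sum_(d <- (st m).2) elt_adj d ** d.
  have [h _ _ _] := inv m; apply: elt_eq => u; rewrite elt_sumE.
  by have /= -> := h idop (fun _ => erefl) u.
have sumF m : let F := elt_defect (st m).1 in
    elt_adj b ** F (F (st m).1) = \sum_(d <- (st m).2) elt_adj (F d) ** F d.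
  move=> F; have [h _ _ _] := inv m; have [Fc _] := defect_commuting (inv m).
  set G := defect (st m).1 in Fc.
  have FFc : commuting b (G \oc G).
    by move=> u; rewrite -[LHS]/(G (G _)) [G (elt_val b _)]Fc [LHS]Fc.
  apply: elt_eq => u; rewrite elt_sumE.
  rewrite -[LHS]/(adjoint b ((G \oc G) ((st m).1 u))) -(h _ FFc).
  apply: eq_bigr => d _ /=; have -> : adjoint (F d) = adjoint d \oc G.
    apply: adjoint_uniq => x y; rewrite -[bop_fun _ x]/(G (d x)) /= -adjointE.
    exact: defect_adj.
  by [].
pose T m := complex.Re (t (elt_adj b ** (st m).1)).
have TS m : T m + 2^-1 * sqn s (elt_defect (st m).1 b) <= T m.+1.
  rewrite /T [(st m.+1).1]/(half *: _ + _) elt_mul_linearr tl ReD ReZ addrC lerD2r.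
  rewrite ler_wpM2l ?invr_ge0// sumF trace_sum.
  have [_ _ _ [hb hn]] := inv m.
  case: ((st m).2) hb hn => //= d r -> _.
  rewrite big_cons ReD /sqn gnsE lerDl.
  elim: r => [|c r ih]; first by rewrite big_nil.
  by rewrite big_cons ReD addr_ge0//; have [] := ge0_Re (tp (elt_defect (st m).1 c)).
have TM m : T m <= sn ip z ^+ 2.
  rewrite /T -(gnsE pd) (le_trans (Re_sip_le _ _ _))// expr2.
  apply: ler_pM; rewrite ?sn_ge0//; apply: (le_trans (sn_gns_norm _)).
    by rewrite ler_piMl ?sn_ge0.
  by rewrite ler_piMl ?sn_ge0.
have [m hm] : exists m, sqn s (elt_defect (st m).1 b) <= e.
  apply: contrapT => /forallNP h.
  have Tm m : T 0%N + m%:R * (2^-1 * e) <= T m.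
    elim: m => [|m ih]; first by rewrite mul0r addr0.
    apply: le_trans (TS m); rewrite -addn1 natrD mulrDl mul1r addrA lerD//.
    by rewrite ler_wpM2l ?invr_ge0//; have /negP := h m; rewrite -ltNge => /ltW.
  have T0 : 0 <= T 0%N by have [] := ge0_Re (tp b).
  have e2 : 0 < 2^-1 * e by rewrite mulr_gt0.
  have := archi_boundP (divr_ge0 (sqr_ge0 (sn ip z)) (ltW e2)).
  set m := Num.bound _; rewrite ltr_pdivrMr// => hm.
  have := Tm m; have := TM m; lra.
by exists (st m).1, (st m).2.
Qed.

End TracialFunctional.

(** * Smooth functionals *)

Section SmoothFunctionals.
Context {R : realType} {H : hilbertType R}.
Local Notation C := R[i].
Variable A : cstar_subalgebra H.
Local Notation E := (cstar_elt A).
Local Notation ip := (ell2ip H).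
Implicit Types (a b c d w : E).
Local Infix "**" := elt_mul (at level 40, left associativity).
Variables (z : ell2 H) (t : E -> C).
Hypothesis pd : dominated_positive z t.
Hypothesis trace : forall a b, t (a ** b) = t (b ** a).
Local Notation s := (gns pd).

Lemma sum_cauchy_schwarz (I : Type) (r : seq I) (x y : I -> R) :
  (\sum_(i <- r) x i * y i) ^+ 2 <= (\sum_(i <- r) x i ^+ 2) * (\sum_(i <- r) y i ^+ 2).
Proof.
apply: discr_le => [||u]; rewrite ?sumr_ge0// => *; rewrite ?sqr_ge0//.
rewrite mulr_suml mulr_sumr mulr_suml -!big_split /= sumr_ge0// => i _.
have := sqr_ge0 (u * x i + y i); nra.
Qed.

Lemma ampZ (k : C) a x : amp a (k *: x) = k *: amp a x.
Proof. by apply: ell2_eq => n /=; rewrite bopZ. Qed.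

Lemma elt_sum_mull (I : Type) (r : seq I) (F : I -> E) c :
  (\sum_(i <- r) F i) ** c = \sum_(i <- r) F i ** c.
Proof.
by apply: elt_eq => u; rewrite elt_sumE -[LHS]/((\sum_(i <- r) F i : E) (c u)) elt_sumE.
Qed.

(* For [b = k b'] with [b'] a contraction, take [w] and [d] as in [polar_approx]:
   then [b'^* a] is close to [\sum_d d^* d w^* a], and by the trace property
   [t (d^* d w^* a)] is the inner product of [a d^*] and [w d^*], while
   [k \sum_d t (d^* d) = t (b^* w) <= delta]. *)
Lemma gns_functional_bound b (delta e : R) : 0 <= delta -> 0 < e ->
  (forall a, cabs (t (elt_adj b ** a)) <= delta * nrm (elt_val a)) ->
  exists xi : ell2 H, sqn ip xi <= delta /\ forall a,
    cabs (t (elt_adj b ** a)) <=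
      Num.sqrt delta * sn ip (amp a xi) + e * sn ip (amp a z).
Proof.
move=> delta0 e0 bdelta.
pose k := nrm (elt_val b) + 1; have k0 : 0 < k by rewrite ltr_wpDl ?nrm_ge0.
pose b' : E := k^-1%:C *: b.
have b'1 : nrm (elt_val b') <= 1.
  rewrite [nrm _](nrmZ k^-1%:C (elt_val b)) cabs_real ger0_norm ?invr_ge0 ?(ltW k0)//.
  by rewrite mulrC ler_pdivrMr// mul1r lerDl.
have bE a : t (elt_adj b ** a) = k%:C * s a b'.
  by rewrite sipZr conjc_real mulrA -rmorphM /= divff ?gt_eqF// mul1r gnsE.
have [w [D [w1 wD Fb]]] := polar_approx pd b'1 (exprn_gt0 2 (divr_gt0 e0 k0)).
have {}Fb : sn s (elt_defect w b') <= e / k.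
  by rewrite -(@ler_pXn2r _ 2)// ?nnegrE ?sn_ge0 ?divr_ge0 ?(ltW e0) ?(ltW k0)// sn_sqr.
have [xi xiP] := choice (fun d => gns_vector pd (elt_adj d)).
have sumD : \sum_(d <- D) sqn s d <= delta / k.
  have -> : \sum_(d <- D) sqn s d = complex.Re (s w b').
    rewrite gnsE wD (trace_sum pd) (big_morph (@complex.Re R) (@ReD R) (erefl _)).
    by apply: eq_bigr => d _; rewrite /sqn gnsE.
  rewrite ler_pdivlMr// mulrC -ReZ -bE (le_trans (Re_le_cabs _))//.
  by rewrite (le_trans (bdelta w))// ler_piMr.
have [zz [zzD zza]] := ell2_flatten_seq [seq xi d | d <- D].
(* The vectors [xi d] belong to [b'], and their squared norms sum to at most [delta / k]; the factor
   restores [delta]. *)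
exists ((Num.sqrt k)%:C *: zz); split=> [|a].
  rewrite sqnZ cabs_real ger0_norm ?sqrtr_ge0// sqr_sqrtr ?(ltW k0)//.
  rewrite mulrC -ler_pdivlMr// (le_trans zzD)// (le_trans _ sumD)// big_map.
  apply: ler_sum => d _; have [h _] := xiP d.
  by rewrite (le_trans h)// -!sn_sqr (sn_adj pd trace).
have split_b : s a b' = \sum_(d <- D) s (a ** elt_adj d) (w ** elt_adj d) +
    s a (elt_defect w b').
  rewrite -[in LHS](subrK (w ** (elt_adj w ** b')) b') addrC sipDr; congr (_ + _).
  rewrite gnsE !elt_adjM elt_adjK wD elt_sum_mull elt_sum_mull (trace_sum pd).
  apply: eq_bigr => d _; rewrite gnsE elt_adjM elt_adjK -2!elt_mulA trace.
  by rewrite !elt_mulA.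
rewrite bE cabsM cabs_real ger0_norm ?(ltW k0)// split_b.
rewrite -ler_pdivlMl// (le_trans (cabsD _ _))// mulrDr lerD//; last first.
  rewrite (le_trans (sip_le _ _ _))// mulrC mulrA [k^-1 * e]mulrC.
  by rewrite ler_pM ?sn_ge0// sn_gns_le.
(* Here |w d^*|_t <= |d^*|_t = |d|_t by traciality, and |a d^*|_t is |a (xi d)|. Cauchy-Schwarz over
   [D] then separates [delta / k] from |a zz|^2. *)
pose S := \sum_(d <- D) sn s d * sn ip (amp a (xi d)).
apply: (@le_trans _ _ S).
  rewrite /S; elim: (D) => [|d r ih]; first by rewrite !big_nil cabs0.
  rewrite !big_cons (le_trans (cabsD _ _))// lerD// (le_trans (sip_le _ _ _))// mulrC.
  rewrite ler_pM ?sn_ge0//; last by rewrite /sn (xiP d).2.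
  rewrite (le_trans (sn_mul_le pd _ _))// (sn_adj pd trace).
  by rewrite ler_piMl ?sn_ge0.
rewrite -(@ler_pXn2r _ 2)// ?nnegrE ?sumr_ge0//; last 2 first.
  by move=> *; rewrite mulr_ge0 ?sn_ge0.
  by rewrite !mulr_ge0 ?invr_ge0 ?sqrtr_ge0 ?sn_ge0 ?(ltW k0).
apply: le_trans (sum_cauchy_schwarz _ _ _) _.
rewrite (eq_bigr _ (fun d _ => sn_sqr s d)).
rewrite (eq_bigr _ (fun d _ => sn_sqr ip (amp a (xi d)))).
rewrite ampZ snZ cabs_real ger0_norm ?sqrtr_ge0// !exprMn sn_sqr !sqr_sqrtr ?(ltW k0)//.
have -> : k^-1 ^+ 2 * (delta * (k * sqn ip (amp a zz))) = delta / k * sqn ip (amp a zz).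
  by field; rewrite gt_eqF.
rewrite ler_pM ?sumr_ge0// => [*|*|]; rewrite ?sqn_ge0//.
by have := zza a; rewrite big_map.
Qed.

(* [b] is [l] times a near-minimiser on the unit ball of
   [l / 2 * |a|_t ^ 2 - Re (f a)]; its first variation bounds [Re (f a - t (b^* a))]
   on the ball by [K x - l x ^ 2] up to small terms, and [l] is chosen large. *)
Lemma smooth_approx (f : E -> C) (M e : R) :
  (forall k a b, f (k *: a + b) = k * f a + f b) ->
  (forall a, cabs (f a) <= M * nrm (elt_val a)) ->
  (forall e, 0 < e -> exists2 d, 0 < d &
    forall a, nrm (elt_val a) <= 1 -> sn s a < d -> cabs (f a) < e) ->
  0 < e ->
  exists b, forall a, cabs (f a - t (elt_adj b ** a)) <= e * nrm (elt_val a).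
Proof.
move=> fl fM fs e0.
suff [b bP] : exists b, forall a, nrm (elt_val a) <= 1 ->
    complex.Re (f a - s a b) <= e.
  exists b => a; rewrite -(gnsE pd); apply/ler_addgt0Pr => r r0.
  pose l := nrm (elt_val a) + r / e.
  have l0 : 0 < l by rewrite ltr_wpDl ?nrm_ge0 ?divr_gt0.
  have [u u1 ua] := phase (f a - s a b).
  pose c : E := (l^-1%:C * u) *: a.
  have c1 : nrm (elt_val c) <= 1.
    rewrite [nrm _](nrmZ _ (elt_val a)) cabsM u1 mulr1 cabs_real ger0_norm ?invr_ge0 ?(ltW l0)//.
    by rewrite mulrC ler_pdivrMr// mul1r lerDl ltW// divr_gt0.
  have fc : f c = l^-1%:C * u * f a.
    have f0 : f 0 = 0 by have := fl (-1) 0 0; rewrite scaler0 addr0 mulN1r addNr.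
    by rewrite -[c]addr0 fl f0 addr0.
  have := bP c c1; rewrite fc sipZl -mulrBr -mulrA ua -rmorphM /=.
  rewrite mulrC ler_pdivrMr// => /le_trans; apply.
  by rewrite /l mulrDr (mulrCA e r) divff ?gt_eqF// mulr1.
(* One third each for the first variation, for [fK], and for the maximum of K x - l x^2. *)
pose e3 := e / 3; have e30 : 0 < e3 by rewrite divr_gt0.
have [d d0 fd] := fs _ e30.
(* If |a|_t < d, smoothness at 0 bounds f(a) by [e3]; otherwise |M| <= K |a|_t. *)
pose K := `|M| / d; have K0 : 0 <= K by rewrite divr_ge0// ltW.
have M0 a : nrm (elt_val a) <= 1 -> cabs (f a) <= `|M|.
  move=> a1; rewrite (le_trans (fM a))// (le_trans (ler_norm _))// normrM.
  by rewrite [`|nrm _|]ger0_norm ?nrm_ge0// ler_piMr.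
have fK a : nrm (elt_val a) <= 1 -> cabs (f a) <= K * sn s a + e3.
  move=> a1; have [ad|ad] := ltP (sn s a) d.
    by rewrite (le_trans (ltW (fd a a1 ad)))// lerDr mulr_ge0// sn_ge0.
  rewrite (le_trans (M0 a a1))// (le_trans (_ : _ <= K * sn s a))//; last by rewrite lerDl ltW.
  by rewrite /K mulrAC ler_pdivlMr// ler_wpM2l.
pose B := sn ip z ^+ 2.
have aB a : nrm (elt_val a) <= 1 -> sn s a <= sn ip z.
  by move=> a1; rewrite (le_trans (sn_gns_norm pd a))// ler_piMl ?sn_ge0.
(* Chosen so that K x - (l - 1) x^2 <= e3 for every x; the summand 1 keeps [l] positive when K =
   0. *)
pose l := K ^+ 2 / (4 * e3) + 1.
have l0 : 0 < l by rewrite ltr_wpDl// divr_ge0 ?sqr_ge0// mulr_ge0// ltW.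
pose J a := l / 2 * sqn s a - complex.Re (f a).
pose U := [set J a | a in [set a : E | nrm (elt_val a) <= 1]].
have hU : has_inf U.
  split; first by exists (J 0), 0 => //=; rewrite [nrm _](@nrm0 _ 'B(H)).
  exists (- `|M|) => _ [a a1 <-]; rewrite /J.
  have := le_trans (Re_le_cabs (f a)) (M0 a a1).
  have := mulr_ge0 (ltW l0) (sqn_ge0 s a); lra.
have B0 : 0 <= B by exact: sqr_ge0.
(* Step length from [b] towards [a]: the quadratic term is at most 2 l B k^2 <= k e3 / 2, and the
   near-minimiser is off by less than k e3 / 2. The extra [e3] in the denominator ensures k <= 1. *)
pose k := e3 / (e3 + 4 * (l * B)).
have lB : 0 <= 4 * (l * B) by exact: mulr_ge0 (ler0n _ _) (mulr_ge0 (ltW l0) B0).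
have kden : 0 < e3 + 4 * (l * B) by rewrite ltr_pwDl.
have k0 : 0 < k by rewrite divr_gt0.
have k1 : k <= 1 by rewrite ler_pdivrMr// mul1r lerDl.
have kB : 4 * (l * B) * k <= e3.
  have kE : k * (e3 + 4 * (l * B)) = e3 by rewrite mulfVK// gt_eqF.
  have : 0 <= k * e3 by rewrite mulr_ge0// ltW.
  by move: kE; lra.
have [_ [b b1 <-] bJ] := inf_adherent (divr_gt0 (mulr_gt0 k0 e30) (ltr0n R 2)) hU.
exists (l%:C *: b) => a a1.
pose c : E := k%:C *: (a - b) + b.
have c1 : nrm (elt_val c) <= 1.
  have -> : c = k%:C *: a + (1 - k)%:C *: b.
    rewrite /c scalerBr rmorphB rmorph1 scalerBl scale1r -addrA; congr (_ + _).
    by rewrite addrC.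
  have -> : elt_val (k%:C *: a + (1 - k)%:C *: b) =
    k%:C *: elt_val a + (1 - k)%:C *: elt_val b by [].
  rewrite (le_trans (nrmD _ _))// !nrmZ !cabs_real ger0_norm ?(ltW k0)//.
  rewrite ger0_norm ?subr_ge0//.
  rewrite -[leRHS](subrK k) addrC lerD//; first by rewrite ler_piMr// subr_ge0.
  by rewrite ler_piMr// ltW.
have Jc : inf U <= J c by apply: ge_inf; [case: hU|exists c].
have fc : complex.Re (f c) = k * (complex.Re (f a) - complex.Re (f b)) + complex.Re (f b).
  rewrite /c fl ReD ReZ; congr (_ * _ + _).
  by have := fl (-1) b a; rewrite scaleN1r mulN1r addrC => ->; rewrite addrC ReB.
have sc : sqn s c = k ^+ 2 * sqn s (a - b) +
    2 * k * (complex.Re (s a b) - sqn s b) + sqn s b.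
  rewrite /c sqnD sqnZ cabs_real real_normK ?num_real// sipZl ReZ sipBl ReB.
  by rewrite -/(sqn s b) mulrA.
have ab : sqn s (a - b) <= 4 * B.
  rewrite -sn_sqr; have := snB s a b; have := aB a a1; have := aB b b1.
  have := sn_ge0 s (a - b); rewrite /B.
  move: (sn s (a - b)) (sn s a) (sn s b) (sn ip z) => x y v r *.
  have : x <= 2 * r by lra.
  nra.
have main : k * (complex.Re (f a) - complex.Re (f b) - l * (complex.Re (s a b) - sqn s b))
    <= k * e3.
  rewrite /J in bJ Jc; rewrite sc fc in Jc.
  have h1 : l / 2 * (k ^+ 2 * sqn s (a - b)) <= l / 2 * (k ^+ 2 * (4 * B)).
    by rewrite ler_wpM2l ?divr_ge0 ?(ltW l0)// ler_wpM2l ?sqr_ge0.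
  have h2 : k * (4 * (l * B) * k) <= k * e3 by rewrite ler_wpM2l// ltW.
  move: bJ Jc h1 h2; move: (sqn s _) (sqn s b) (complex.Re (s a b)) => X Y P.
  move: (inf U) (complex.Re (f a)) (complex.Re (f b)) => I F G *; lra.
rewrite ler_pM2l// in main.
rewrite ReB sipZr conjc_real ReZ.
have fb := le_trans (Re_le_cabs _) (fK b b1).
have h : K * sn s b - l * sqn s b <= e3.
  rewrite -sn_sqr; set x := sn s b; have := sqr_ge0 x.
  have lK : l - 1 = K ^+ 2 / (4 * e3) by rewrite /l addrK.
  have : K * x - (l - 1) * x ^+ 2 <= e3.
    rewrite lK -(ler_pM2r (_ : 0 < 4 * e3)) ?mulr_gt0//.
    have -> : (K * x - K ^+ 2 / (4 * e3) * x ^+ 2) * (4 * e3) =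
        4 * e3 * (K * x) - (K * x) ^+ 2 by field; rewrite gt_eqF.
    by have := sqr_ge0 (K * x - 2 * e3); nra.
  lra.
have -> : e = 3 * e3 by rewrite /e3 mulrC divfK.
lra.
Qed.

(** An error proportional to |a| cannot be dominated by a vector, so the bound by |a zz| is proved
    for every t(b_n^* a) with a constant independent of n; the error disappears in the limit. *)
Lemma smooth_vector_functional (f : E -> C) (M : R) :
  (forall k a b, f (k *: a + b) = k * f a + f b) ->
  (forall a, cabs (f a) <= M * nrm (elt_val a)) ->
  (forall e, 0 < e -> exists2 d, 0 < d &
    forall a, nrm (elt_val a) <= 1 -> sn s a < d -> cabs (f a) < e) ->
  exists x y : ell2 H, forall a, f a = ip (amp a x) y.
Proof.
move=> fl fM fs; have [tl _ _ _] := pd.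
pose q n : R := 2^-1 ^+ n.
have q0 n : 0 < q n by rewrite exprn_gt0.
have q1 n : q n <= 1 by rewrite exprn_ile1//; lra.
have sumq n : \sum_(k < n) q k <= 2.
  suff -> : \sum_(k < n) q k = 2 - 2 * q n by have := q0 n; lra.
  elim: n => [|n ih]; first by rewrite big_ord0 /q expr0; lra.
  by rewrite big_ord_recr /= ih /q exprS; lra.
(* Tolerance q^2 makes the differences of norm at most (2 q)^2, whose square root 2 q is
   summable. *)
have [b bP] := choice (fun k => smooth_approx fl fM fs (exprn_gt0 2 (q0 k))).
pose g k := b k.+1 - b k.
have tB x y a : t (elt_adj (x - y) ** a) = t (elt_adj x ** a) - t (elt_adj y ** a).
  by rewrite -!(gnsE pd) sipBr.
have gP k a : cabs (t (elt_adj (g k) ** a)) <= (2 * q k) ^+ 2 * nrm (elt_val a).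
  have -> : t (elt_adj (g k) ** a) =
    (f a - t (elt_adj (b k) ** a)) - (f a - t (elt_adj (b k.+1) ** a)).
    by rewrite /g tB; ring.
  rewrite (le_trans (cabsD _ _))// cabsN.
  have := bP k a; have := bP k.+1 a.
  have -> : q k.+1 = q k / 2 by rewrite /q exprS mulrC.
  have := nrm_ge0 (elt_val a); have := sqr_ge0 (q k).
  move: (nrm _) => N; move: (q k) => r; nra.
have [xi xiP] := choice (fun k => gns_functional_bound (sqr_ge0 (2 * q k)) (q0 k) (gP k)).
(* [z] occupies index 0, so that [zz] also dominates the starting functional and the small terms in
   |a z|. *)
pose X k := if k is n.+1 then xi n else z.
have [n|zz [_ zza]] := @ell2_flatten R H X (sqn ip z + 8).
  case: n => [|n]; first by rewrite big_ord0 addr_ge0 ?sqn_ge0.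
  rewrite big_ord_recl /= lerD2l.
  apply: (@le_trans _ _ (4 * \sum_(k < n) q k)); last by have := sumq n; lra.
  rewrite mulr_sumr; apply: ler_sum => k _; have [h _] := xiP k.
  rewrite (le_trans h)// exprMn -natrX.
  have := q0 k; have := q1 k; move: (q k) => r; nra.
have Xle k a : sn ip (amp a (X k)) <= sn ip (amp a zz).
  rewrite ler_wsqrtr// -lee_fin zza.
  apply: le_trans (nneseries_lim_ge k.+1 _); last by move=> *; rewrite lee_fin sqn_ge0.
  rewrite big_nat_recr//= leeDr// sume_ge0// => *; by rewrite lee_fin sqn_ge0.
(* Each difference adds 2 q |a xi| + q |a z| <= 3 q |a zz|, and the q sum to at most 2. *)
have bn n a : cabs (t (elt_adj (b n) ** a)) <=
    (sn s (b 0%N) + 3 * \sum_(k < n) q k) * sn ip (amp a zz).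
  elim: n => [|n ih].
    rewrite big_ord0 mulr0 addr0 -(gnsE pd) (le_trans (sip_le _ _ _))// mulrC.
    rewrite ler_wpM2l ?sn_ge0//; exact: le_trans (sn_gns_le pd a) (Xle 0%N a).
  have -> : t (elt_adj (b n.+1) ** a) = t (elt_adj (b n) ** a) + t (elt_adj (g n) ** a).
    by rewrite /g tB; ring.
  rewrite (le_trans (cabsD _ _))// big_ord_recr /= mulrDr addrA mulrDl lerD//.
  have [_ h] := xiP n; rewrite (le_trans (h a))// sqrtr_sqr ger0_norm; last first.
    by rewrite mulr_ge0// ltW.
  have := Xle n.+1 a; have := Xle 0%N a; have := q0 n; rewrite /=; nra.
have jl : linear (fun a : E => amp a zz) by move=> k a c; exact: ell2_eq.
have fb a : cabs (f a) <= (sn s (b 0%N) + 6) * sn ip (amp a zz).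
  rewrite -subr_le0; apply: (@le_geom0 _ _ (nrm (elt_val a))) => n.
  rewrite lerBlDl -[f a](subrK (t (elt_adj (b n) ** a))) (le_trans (cabsD _ _))// addrC.
  rewrite lerD//.
    rewrite (le_trans (bn n a))// ler_wpM2r ?sn_ge0// lerD2l.
    by have := sumq n; lra.
  rewrite (le_trans (bP n a))// mulrC ler_wpM2l ?nrm_ge0//.
  by rewrite -[leRHS]mul1r expr2 ler_pM ?(ltW (q0 _)).
have [y [yP _]] := riesz jl (@ell2_complete R H) fl fb.
by exists zz, y.
Qed.

End SmoothFunctionals.

(** * Cochains *)

Section AutomaticNormality.
Context {R : realType} {H : hilbertType R}.
Local Notation C := R[i].
Variables (A : cstar_subalgebra H) (tau : 'B(H) -> C).
Hypothesis tauP : faithful_normal_trace (uw_closure A) tau.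
Local Notation E := (cstar_elt A).
Local Notation ip := (ell2ip H).

Lemma uw_functional_continuous (p : l2pair H) :
  continuous ((fun T => uw_functional T p) : uwot H -> C^o).
Proof.
move=> T; apply: (@continuous_comp _ _ _
  (@uw_functional R H : uwot H -> {ptws l2pair H -> C^o}) (fun g => g p)).
  exact: initial_continuous.
move: (uw_functional T) => g.
have /cvg_sup/(_ p) h : nbhs (g : {ptws l2pair H -> C^o}) -->
  (g : {ptws l2pair H -> C^o}) by exact: cvg_id.
move=> U gU; apply: h.
exact: (@initial_continuous (l2pair H -> C^o) C^o (fun f => f p) g U gU).
Qed.

Lemma trace_dominated : exists z, dominated_positive z (fun a : E => tau a).
Proof.
have NA T : T \in A -> uw_closure A T by move=> TA; exact: subset_closure.
have tl a S T : S \in A -> T \in A -> tau (a *: S + T) = a * tau S + tau T.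
  by move=> SA TA; apply: (trace_linear tauP); exact: NA.
have [z [zle [M zM]]] := normal_dominated tl (trace_normal tauP).
exists z; split=> [k a b|a|a|].
- by apply: tl; exact: elt_in.
- by apply: (trace_ge0 tauP); exact/NA/elt_in.
- exact: le_trans (Re_le_cabs _) (zle _ (elt_in a)).
- by exists M => a; exact/zM/elt_in.
Qed.

Lemma trace_elt_comm (a b : E) : tau (elt_mul a b) = tau (elt_mul b a).
Proof. by apply: (trace_comm tauP); exact: cstar_in_closure. Qed.

Lemma trace_norm_gns z (pd : dominated_positive z (fun a : E => tau a)) (a : E) :
  trace_norm tau a = (sn (gns pd) a)%:C.
Proof.
have -> : trace_norm tau a = sqrtC (gns pd a a) by rewrite gnsE.
by rewrite sqnE -sn_sqr rmorphXn sqrCK// ler0c sn_ge0.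
Qed.

Lemma smooth_functional_continuous (f : E -> C^o) (M : R) :
  (forall k a b, f (k *: a + b) = k * f a + f b) ->
  (forall a, cabs (f a) <= M * nrm (elt_val a)) ->
  smooth tau f -> continuous (f : elt_uwot A -> C^o).
Proof.
move=> fl fM fs; have [z pd] := trace_dominated.
have f0 : f 0 = 0 by have := fl (-1) 0 0; rewrite scaler0 addr0 mulN1r addNr.
have [//|x [y fE]] := smooth_vector_functional (pd := pd) trace_elt_comm fl fM.
  move=> e e0; have e1 : 0 < e%:C by rewrite ltcR.
  have [|d d0 fd] := fs 0 _ _ e1; first by rewrite [`|_|](@normr0 _ 'B(H)).
  have [_ dE] := ge0_Re (ltW d0).
  exists (complex.Re d); first by rewrite -ltcR -dE.
  move=> a a1 ad; rewrite -ltcR -cabsE -[f a]subr0 -f0.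
  apply: fd; first by rewrite nrmE lecR.
  by rewrite subr0 (trace_norm_gns pd) dE ltcR.
have -> : f = (fun a => uw_functional a (pair_of_ell2 x y)) by apply/funext.
move=> a; have vc : continuous (@elt_val R H A : elt_uwot A -> uwot H) by exact: initial_continuous.
apply: (@continuous_comp _ _ _ (@elt_val R H A : elt_uwot A -> uwot H)
  (fun T => uw_functional T (pair_of_ell2 x y))); first exact: vc.
exact: uw_functional_continuous.
Qed.

Variables (Y : completeNormedModType C) (X : banach_bimodule (uw_closure A) (dual Y)).

(** The weak* topology is pointwise on [Y], so fixing [y] and all arguments but one leaves a bounded
    smooth scalar functional. In degree 0 there is no slot to check. *)
Lemma BL_smooth_weak n (T : ('I_n -> E) -> dual Y) :
  T \in BL tau X Smooth (n := n) -> T \in BL tau X SmoothWeak (n := n).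
Proof.
move=> /BLP[Tl [K TK] Te Ts _]; apply/BLP; split=> //; first by exists K.
move=> _ x i; apply/continuous_initial_ptws => y.
pose P : C := \prod_(j < n | j != i) `|elt_val (x j)|.
have bound a : `|partial T x i a| <= `|K| * P * `|elt_val a|.
  have TKa : `|partial T x i a| <= K * (`|elt_val a| * P).
    have := TK (dfwith x i a); rewrite (bigD1 i)//= dfwithin.
    rewrite (eq_bigr (fun j => `|elt_val (x j)|))// => j ji.
    by rewrite dfwithout// eq_sym.
  rewrite (le_trans TKa)//.
  have P0 : 0 <= P by apply: prodr_ge0.
  (* [K] is an arbitrary element of [R[i]], but the right-hand side dominates a norm and hence
     equals its own modulus. *)
  have /ger0_norm <- := le_trans (normr_ge0 _) TKa.
  by rewrite !normrM normr_id (ger0_norm P0) mulrAC mulrA.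
apply: (@smooth_functional_continuous _ (complex.Re (`|K| * P) * nrm y)).
- by move=> k a b; rewrite Tl.
- move=> a; rewrite (le_trans (nrm_bop (partial T x i a) y))// mulrAC.
  rewrite ler_wpM2r ?nrm_ge0// -lecR rmorphM /= -!nrmE.
  rewrite RRe_real ?bound// ger0_real// mulr_ge0//; exact: prodr_ge0.
move=> a a1 e e0; have e1 : 0 < e / (`|y| + 1).
  by rewrite divr_gt0// ltr_wpDl.
have [d d0 h] := Ts x i a a1 _ e1; exists d => // c c1 cd.
have := h c c1 cd; rewrite ltr_pdivlMr ?ltr_wpDl// => hc.
have -> : partial T x i c y - partial T x i a y = (partial T x i c - partial T x i a) y by [].
rewrite (le_lt_trans (ler_bop _ _))// (le_lt_trans _ hc)// ler_wpM2l//.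
by rewrite lerDl.
Qed.

Lemma BL_smoothE n : BL tau X SmoothWeak (n := n) =i BL tau X Smooth (n := n).
Proof.
move=> T; apply/idP/idP; last exact: BL_smooth_weak.
by move=> /BLP[? ? ? ? _]; apply/BLP; split.
Qed.

Lemma cocycle_weaken_subproof n (c : cocycle tau X Smooth n) :
  cocycle_val c \in is_cocycle tau X SmoothWeak (n := n).
Proof. by have /andP[h h'] := cocycleP c; apply/andP; split; rewrite ?BL_smoothE. Qed.

Definition cocycle_weaken n (c : cocycle tau X Smooth n) : cocycle tau X SmoothWeak n :=
  Cocycle (cocycle_weaken_subproof c).

Lemma cohomology_class_eq k n (u v : cocycle tau X k n.+1) :
  cohomology_class u = cohomology_class v <->
  exists2 psi, psi \in BL tau X k (n := n) &
    cocycle_val u - cocycle_val v = coboundary X psi.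
Proof.
split=> [/lmod_classP/asboolP//|h]; apply/lmod_classP; exact/asboolP.
Qed.

End AutomaticNormality.

Theorem theorem1p2 (R : realType) (H : hilbertType R) (A : cstar_subalgebra H)
    (tau : 'B(H) -> R[i]) (Y : completeNormedModType R[i])
    (X : banach_bimodule (uw_closure A) (dual Y)) :
  faithful_normal_trace (uw_closure A) tau ->
  normal_dual_bimodule X ->
  forall n : nat,
  exists phi : {linear cohomologyS tau X SmoothWeak n -> cohomologyS tau X Smooth n},
    (forall z : cocycle tau X SmoothWeak n.+1,
       phi (cohomology_class z) = cohomology_class (cocycle_incl z)) /\
    bijective phi.
Proof.
move=> tauP _ n.
have surj k (c : cohomologyS tau X k n) : exists z, c = cohomology_class z.
  exact: lmod_class_surj.
have clin k : linear (@cohomology_class _ _ _ tau _ X k n).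
  exact: lmod_class_linear.
have [r rP] := choice (surj SmoothWeak).
have [r' rP'] := choice (surj Smooth).
pose phi c := cohomology_class (cocycle_incl (r c)).
(* The equality of cochains in degree n + 1 provides the map on cocycles, that in degree n makes it
   compatible with coboundaries. *)
pose psi c := cohomology_class (cocycle_weaken tauP (r' c)).
have phiE z : phi (cohomology_class z) = cohomology_class (cocycle_incl z).
  have /cohomology_class_eq[p pB pE] := esym (rP (cohomology_class z)).
  by apply/cohomology_class_eq; exists p; rewrite // -(BL_smoothE tauP).
have psiE z : psi (cohomology_class z) = cohomology_class (cocycle_weaken tauP z).
  have /cohomology_class_eq[p pB pE] := esym (rP' (cohomology_class z)).
  by apply/cohomology_class_eq; exists p; rewrite // (BL_smoothE tauP).
have phi_linear : linear phi.
  move=> a c d; rewrite [c]rP [d]rP -clin !phiE -clin; congr cohomology_class.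
  exact: val_inj.
pose phiL := GRing.isLinear.Build _ _ _ _ phi phi_linear.
pose Phi : {linear _ -> _} := HB.pack phi phiL.
exists Phi; split; first exact: phiE.
exists psi => c.
- have [z ->] := surj _ c; rewrite [Phi _]phiE psiE; congr cohomology_class.
  exact: val_inj.
- have [z ->] := surj _ c; rewrite psiE [LHS]phiE; congr cohomology_class.
  exact: val_inj.
Qed.
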